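(* Let $(e,l,K)$ be a graph model, let $f,g$ be the associated polynomials and let $S=\langle \exp(f),\exp(tg)\rangle\in\mathbb{Q}[[t]]$. Run Algorithm 1 (described in the context) on input $(e,l,K)$. Algorithm 1 is correct, that is: if it terminates, then either it gives up by returning `FAIL' at Step (f), or it outputs at Step (j) a (non-trivial) linear differential operator $q_0+q_1\partial_t+\dots+q_\delta\partial_t^\delta$ with $q_i\in\mathbb{Q}(t)$ that annihilates the scalar product $S$.
   Context: A graph model is a triple $(e,l,K)$ with $e\in\{\text{se},\text{me}\}$, $l\in\{\text{ll},\text{la},\text{lh}\}$, $K$ a finite non-empty set of positive integers. Put $k=\max K$, $p=(p_1,\dots,p_k)$, $\partial=(\partial_1,\dots,\partial_k)$. For a partition $\lambda=(\lambda_1,\lambda_2,\dots)$ with $r_i$ parts equal to $i$, put $p_\lambda=p_{\lambda_1}p_{\lambda_2}\cdots$ and $z_\lambda=\prod_i i^{r_i}r_i!$. The scalar product is the bilinear pairing with $\langle p_\lambda,p_\nu\rangle=z_\lambda$ if $\lambda=\nu$ and $0$ otherwise, extended to $\mathbb{Q}[[p]]\times\mathbb{Q}[p][[t]]\to\mathbb{Q}[[t]]$ coefficientwise in $t$. $\delta_{x,y}$ is $1$ if $x=y$ and $0$ otherwise. $W_p$ is the Weyl algebra $\mathbb{Q}\langle p,\partial\rangle$ with commutation rules $\partial_ip_j=p_j\partial_i+\delta_{i,j}$, and $W_p(t)=\mathbb{Q}(t)\otimes_{\mathbb{Q}} W_p$; it acts on $\mathbb{Q}(t)[p]$ on the left,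 $\partial_i$ acting as $\partial/\partial p_i$; $\partial_t$ denotes $d/dt$. As a right $\mathbb{Q}(t)[p]$-module, $W_p(t)$ is free with basis $\{\partial^\alpha\}_\alpha$. Fix a monomial ordering $\prec_p$ on $\mathbb{Q}(t)[p]$ graded by total degree. Algorithm 1: (a) Set $k=\max K$ and, with $\epsilon_i=(-1)^{i+1}\delta_{e,\text{se}}+\delta_{e,\text{me}}$, $$f=\sum_{i=1}^k\epsilon_i\Bigl(\frac{p_i^2}{2i}+\delta_{l,\text{lh}}\frac{p_i}{i}\Bigr)-(-1)^{\delta_{l,\text{la}}}\sum_{i=1}^{\lfloor k/2\rfloor}\epsilon_i\frac{p_{2i}}{2i},\qquad g=\sum_{j\in K}\sum_{\lambda\vdash j}\frac{p_\lambda}{z_\lambda}.$$ (b) With $f_i=\partial f/\partial p_i$, $g_i=\partial g/\partial p_i$, compute for $1\le i\le k$ the operators $P_i^\sharp=p_i-i f_i\bigl(\partial_1+tg_1,2(\partial_2+tg_2),\dots,k(\partial_k+tg_k)\bigr)\in W_p(t)$ (non-commutative substitution of $p_j$ by $j(\partial_j+tg_j)$ in the polynomial $f_i$). (c) Transform each $P_i^\sharp=\sum_\alpha\partial^\alpha c_\alpha$ ($c_\alpha\in\mathbb{Q}(t)[p]$) into $\eta_1c_0+\sum_{\alpha\ne0}\partial^\alpha\eta_0\,c_\alpha$, an element of the free right $\mathbb{Q}(t)[p]$-module with basis $\{\eta_1\}\cup\{\partial^\alpha\eta_0\}_\alpha$, $\alpha$ ranging over the finite set of non-zero exponents occurring.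 (d) Compute a Gröbner basis of the right $\mathbb{Q}(t)[p]$-submodule generated by these elements, for a module monomial ordering in which every monomial $\eta_1p^\gamma$ is larger than every monomial in the $\partial^\alpha\eta_0$ components, monomials in the $\eta_1$ component are compared by $\prec_p$, and those in the $\partial^\alpha\eta_0$ components are compared first through their $p$-part, then through $\partial^\alpha$. (e) From the Gröbner basis elements with non-zero $\eta_1$-coefficient, obtain $G_1,\dots,G_\rho\in W_p(t)$ by setting $\eta_1=\eta_0=1$; write $G_i=Q_i+R_i$ where $Q_i\in\mathbb{Q}(t)[p]$ is the $\eta_1$-coefficient and each monomial of $R_i$ involves at least one $\partial_j$. (f) Let $I=(Q_1,\dots,Q_\rho)\subset\mathbb{Q}(t)[p]$. If $I$ has positive dimension, return `FAIL'. Otherwise let $p^{\beta_1},\dots,p^{\beta_\delta}$ be the monomials under the stairs of $I$, i.e. those that are not leading monomials of elements of $I$ for $\prec_p$. (g) Set $\check g_0=1$, and for $i=1,\dots,\delta$ set $\check g_i=\operatorname{red}(g\,\check g_{i-1}+\partial_t\cdot\check g_{i-1})$. (h) Form the $(\delta+1)\times\delta$ matrix $M$ over $\mathbb{Q}(t)$ whose entry at $(i,j)$, $0\le i\le\delta$, $1\le j\le\delta$, is the coefficient of $p^{\beta_j}$ in $\check g_i$. (i) Compute a basis of the left kernel of $M$, and combine its elements to obtain a non-zero row vector $(q_0,\dots,q_\delta)\in\mathbb{Q}(t)^{\delta+1}$ in the left kernel with maximal number of zeros to the right. (j) Return $q_0+q_1\partial_t+\dots+q_\delta\partial_t^\delta$.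 The recursive procedure $\operatorname{red}(s)$, for $s\in\mathbb{Q}(t)[p]$: let $m_i$ be the leading monomial and $c_i$ the leading coefficient of $Q_i$ for $\prec_p$. If no monomial of $s$ is divisible by any $m_i$, return $s$. Otherwise let $m$ be the maximal monomial of $s$ divisible by some $m_i$, choose $j$ with $m_j\mid m$, let $c$ be the coefficient of $m$ in $s$, put $\tau=\frac{c}{c_j}\frac{m}{m_j}$ and return $\operatorname{red}(s-G_j\cdot\tau)$. *)

(* Defs.v *)
(* Mathematical Components, with finmap and multinomials. *)
From HB Require Import structures.
From mathcomp Require Import all_boot all_order all_algebra finmap.
From mathcomp.multinomials Require Import mpoly.

Set Implicit Arguments.
Unset Strict Implicit.
Unset Printing Implicit Defensive.

Import Order.TTheory GRing.Theory Num.Theory.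
Local Open Scope ring_scope.

(** * Weyl algebra *)

(** An element [P : weyl R n] stands for the sum of the [∂^α P@_α], with the
    coefficients [P@_α] in [R[p]] on the right of the derivations: this is the
    normal form with respect to the basis [∂^α] of the Weyl algebra as a right
    [R[p]]-module. The additive structure is that of polynomials in [∂] over
    [R[p]], but the product is the non-commutative one. *)
Definition weyl (R : comNzRingType) (n : nat) : Type := {mpoly {mpoly R[n]}[n]}.

Section WeylProduct.
Variables (R : comNzRingType) (n : nat).
Local Notation A := {mpoly R[n]}.
Local Notation W := {mpoly {mpoly R[n]}[n]}.
Implicit Types (P Q : W) (c : A) (T : W -> W).

(** Left multiplication by [p_i]: [p_i ∂^α = ∂^α p_i - α_i ∂^(α - e_i)]. *)
Definition lmul_var (i : 'I_n) Q : W := ('X_i : A) *: Q - Q^`M(i).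

Definition lmul_mon (m : 'X_{1..n}) Q : W :=
  foldr (fun i => iter (m i) (lmul_var i)) Q (enum 'I_n).

Definition lmul_poly c Q : W :=
  \sum_(m <- msupp c) (c@_m)%:MP_[n] *: lmul_mon m Q.

(** [(∂^α c) * Q = ∂^α * (c * Q)], and left multiplication by [∂^α] only
    shifts exponents. *)
Definition weyl_mul P Q : W :=
  \sum_(a <- msupp P) 'X_[a] * lmul_poly P@_a Q.

(** Right multiplication by [∂_i]: [c ∂_i = ∂_i c - ∂c/∂p_i]. *)
Definition rmul_d (i : 'I_n) Q : W := 'X_i * Q - map_mpoly (mderiv i) Q.

(** Left multiplications commute with all right multiplications, and a map that
    does so is determined by its value at 1: associativity follows. *)
Record right_linear T : Prop := RightLinear {
  _ : {morph T : P Q / P + Q};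
  _ : forall c Q, T (c *: Q) = c *: T Q;
  _ : forall i Q, T (rmul_d i Q) = rmul_d i (T Q) }.

Let subm_id (m : 'X_{1..n}) : (m - m)%MM = 0%MM.
Proof. by apply/mnmP=> i; rewrite mnmBE subnn mnm0E. Qed.

Let coef_dp i Q m : (map_mpoly (mderiv i) Q)@_m = (Q@_m)^`M(i).
Proof. exact: mcoeff_map_mpoly. Qed.

Let rmul_dD i : {morph rmul_d i : P Q / P + Q}.
Proof.
by move=> P Q; rewrite /rmul_d raddfD mulrDr opprD addrACA.
Qed.

Let dpX i m Q : map_mpoly (mderiv i) ('X_[m] * Q) = 'X_[m] * map_mpoly (mderiv i) Q.
Proof.
apply/mpolyP=> k; rewrite coef_dp -!commr_mpolyX.
have [/submK <-|] := boolP (m <= k)%MM; first by rewrite addmC !mcoeffMX coef_dp.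
move=> nmk; have no P : (P * 'X_[m])@_k = 0.
  apply/memN_msupp_eq0; rewrite (perm_mem (msuppMX _ _)); apply/mapP=> -[k' _ kE].
  by move: nmk; rewrite kE lem_addr.
by rewrite !no mderiv0.
Qed.

Let lin_id : right_linear id. Proof. by []. Qed.

Let lin_comp T1 T2 : right_linear T1 -> right_linear T2 -> right_linear (T1 \o T2).
Proof.
case=> a1 b1 c1 [a2 b2 c2]; split=> [P Q|c Q|i Q] /=.
- by rewrite a2 a1.
- by rewrite b2 b1.
- by rewrite c2 c1.
Qed.

Let rmul_d_sum i (I : Type) (r : seq I) (F : I -> W) :
  rmul_d i (\sum_(x <- r) F x) = \sum_(x <- r) rmul_d i (F x).
Proof.
have r0 : rmul_d i 0 = 0.
  by apply: (addrI (rmul_d i 0)); rewrite -rmul_dD !addr0.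
exact: (big_morph (rmul_d i) (rmul_dD i) r0).
Qed.

Let lin_sum (I : Type) (r : seq I) (F : I -> W -> W) :
  (forall x, right_linear (F x)) -> right_linear (fun Q => \sum_(x <- r) F x Q).
Proof.
move=> linF; split=> [P Q|c Q|i Q].
- by rewrite -big_split; apply: eq_bigr => x _; case: (linF x).
- by rewrite scaler_sumr; apply: eq_bigr => x _; case: (linF x).
- by rewrite rmul_d_sum; apply: eq_bigr => x _; case: (linF x).
Qed.

Let dpZ i c Q :
  map_mpoly (mderiv i) (c *: Q) = c^`M(i) *: Q + c *: map_mpoly (mderiv i) Q.
Proof.
apply/mpolyP=> m; rewrite mcoeffD coef_dp.
rewrite (mcoeffZ c Q m) (mcoeffZ _ Q m) (mcoeffZ c _ m) coef_dp.
exact: mderivM.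
Qed.

Let lin_var j : right_linear (lmul_var j).
Proof.
split=> [P Q|c Q|i Q]; rewrite /lmul_var.
- by rewrite mderivD scalerDr opprD addrACA.
- by rewrite mderivZ scalerBr !scalerA mulrC.
have dd : (map_mpoly (mderiv i) Q)^`M(j) = map_mpoly (mderiv i) (Q^`M(j)).
  by apply/mpolyP=> m; rewrite mcoeff_deriv !coef_dp mcoeff_deriv mderivMn.
have dB : map_mpoly (mderiv i) ('X_j *: Q - Q^`M(j)) =
    map_mpoly (mderiv i) ('X_j *: Q) - map_mpoly (mderiv i) Q^`M(j).
  exact: raddfB.
rewrite /rmul_d mderivB mderivM dd dB dpZ !mderivX !mnm1E.
have -> : (i == j)%:R *: 'X_[U_(i) - U_(j)] = (i == j)%:R :> W.
  by case: eqVneq => [->|_]; rewrite ?scale0r // scale1r subm_id mpolyX0.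
have -> : (j == i)%:R *: 'X_[U_(j) - U_(i)] = (i == j)%:R :> A.
  rewrite eq_sym; case: eqVneq => [->|_]; rewrite ?scale0r //.
  by rewrite scale1r subm_id mpolyX0.
have -> : (i == j)%:R *: Q = (i == j)%:R * Q.
  by case: (i == j); rewrite ?scale1r ?mul1r ?scale0r ?mul0r.
rewrite scalerBr mulrBr -scalerAr !opprD !addrA.
by rewrite [LHS](ACl (1 * 4 * 3 * 2 * 5)).
Qed.

Let lin_mon m : right_linear (lmul_mon m).
Proof.
rewrite /lmul_mon; elim: (enum 'I_n) => [|i s IHs]; first exact: lin_id.
rewrite /=; elim: (m i) => [|k IHk]; first exact: IHs.
exact: (lin_comp (lin_var i) IHk).
Qed.

Let lin_scale (a : R) T : right_linear T -> right_linear (fun Q => a%:MP_[n] *: T Q).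
Proof.
case=> aT bT cT; split=> [P Q|c Q|i Q].
- by rewrite aT scalerDr.
- by rewrite bT !scalerA mulrC.
- by rewrite cT /rmul_d dpZ mderivC scale0r add0r scalerBr scalerAr.
Qed.

Let lin_shift m T : right_linear T -> right_linear (fun Q => 'X_[m] * T Q).
Proof.
case=> aT bT cT; split=> [P Q|c Q|i Q].
- by rewrite aT mulrDr.
- by rewrite bT scalerAr.
- by rewrite cT /rmul_d dpX mulrBr mulrCA.
Qed.

Let lin_poly c : right_linear (lmul_poly c).
Proof. by apply: lin_sum => m; apply/lin_scale/lin_mon. Qed.

Let lin_mul P : right_linear (weyl_mul P).
Proof. by apply: lin_sum => m; apply/lin_shift/lin_poly. Qed.

Let lmul_poly1 c : lmul_poly c 1 = c%:MP.
Proof.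
have mon1 m : lmul_mon m 1 = ('X_[m] : A)%:MP.
  rewrite /lmul_mon mpolyXE_id.
  have -> : \prod_(i < n) 'X_i ^+ m i = \prod_(i <- enum 'I_n) 'X_i ^+ m i :> A.
    by rewrite [RHS]big_enum.
  elim: (enum 'I_n) => [|i s IHs] /=; first by rewrite big_nil mpolyC1.
  rewrite IHs big_cons; elim: (m i) => [|k IHk] /=; first by rewrite expr0 mul1r.
  by rewrite IHk /lmul_var mderivC subr0 exprS -mulrA -mul_mpolyC -mpolyCM.
rewrite [in RHS](mpolyE c) raddf_sum; apply: eq_bigr => m _ /=.
by rewrite mon1 -[LHS]mul_mpolyC -mpolyCM mul_mpolyC.
Qed.

Let weyl_mulr1 P : weyl_mul P 1 = P.
Proof.
rewrite [RHS]mpolyE; apply: eq_bigr => a _.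
by rewrite lmul_poly1 mulrC mul_mpolyC.
Qed.

Let weyl_mul1r P : weyl_mul 1 P = P.
Proof.
rewrite /weyl_mul msupp1 big_seq1 mcoeff1 eqxx mpolyX0 mul1r.
rewrite /lmul_poly msupp1 big_seq1 mcoeff1 eqxx mpolyC1 scale1r /lmul_mon.
by elim: (enum 'I_n) => //= i s ->; rewrite mnm0E.
Qed.

Let lin_eq T1 T2 : right_linear T1 -> right_linear T2 -> T1 1 = T2 1 -> T1 =1 T2.
Proof.
move=> [a1 b1 c1] [a2 b2 c2] e1.
have eX m : T1 'X_[m] = T2 'X_[m].
  have [d] := ubnP (mdeg m); elim: d m => // d IHd m.
  have [->|nz_m] := eqVneq m 0%MM; first by rewrite mpolyX0.
  have [i mi] : exists i, m i != 0%N.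
    apply/existsP; move: nz_m; apply: contraNT; rewrite negb_exists => /forallP z.
    by apply/eqP/mnmP=> i; rewrite mnm0E; have := z i; rewrite negbK => /eqP.
  have mE : (U_(i) + (m - U_(i)) = m)%MM by rewrite addmC submK // lep1mP.
  have XE : 'X_[m] = rmul_d i 'X_[m - U_(i)].
    rewrite /rmul_d -mpolyXD mE -[in X in _ - X](mulr1 'X_[_]) dpX.
    rewrite -mpolyC1 (_ : map_mpoly _ _ = 0) ?mulr0 ?subr0 //.
    by apply/mpolyP=> k; rewrite coef_dp mcoeffC mcoeff0 -mpolyC_nat -mpolyCM mderivC.
  rewrite XE c1 c2 ltnS -{1}mE mdegD mdeg1 => lt_d; congr rmul_d.
  by apply: IHd; rewrite -ltnS.
have T0 T : {morph T : P Q / P + Q} -> T 0 = 0.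
  by move=> aT; apply: (addrI (T 0)); rewrite -aT !addr0.
move=> Q; rewrite [Q]mpolyE (big_morph T1 a1 (T0 _ a1)) (big_morph T2 a2 (T0 _ a2)).
by apply: eq_bigr => m _; rewrite b1 b2 eX.
Qed.

Let weyl_mulA : associative weyl_mul.
Proof.
move=> P Q S; apply: (lin_eq (lin_comp (lin_mul P) (lin_mul Q)) (lin_mul _)).
by rewrite /= !weyl_mulr1.
Qed.

Let weyl_mulDr : right_distributive weyl_mul +%R.
Proof. by move=> P; case: (lin_mul P). Qed.

Let lin_add T1 T2 : right_linear T1 -> right_linear T2 ->
  right_linear (fun Q => T1 Q + T2 Q).
Proof.
move=> [a1 b1 c1] [a2 b2 c2]; split=> [P Q|c Q|i Q].
- by rewrite a1 a2 addrACA.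
- by rewrite b1 b2 scalerDr.
- by rewrite c1 c2 rmul_dD.
Qed.

Let weyl_mulDl : left_distributive weyl_mul +%R.
Proof.
move=> P Q S; apply: (lin_eq (lin_mul (P + Q)) (lin_add (lin_mul P) (lin_mul Q))).
by rewrite !weyl_mulr1.
Qed.

HB.instance Definition _ := GRing.Zmodule.on (weyl R n).
HB.instance Definition _ := GRing.Zmodule_isNzRing.Build (weyl R n)
  weyl_mulA weyl_mul1r weyl_mulr1 weyl_mulDl weyl_mulDr (oner_neq0 W).

End WeylProduct.

Section WeylTheory.
Variables (R : comNzRingType) (n : nat).

Definition weylC (c : {mpoly R[n]}) : weyl R n := c%:MP.

Definition weylD (i : 'I_n) : weyl R n := 'X_i.

Lemma weyl_comm (i j : 'I_n) :
  weylD i * weylC 'X_j = weylC 'X_j * weylD i + (i == j)%:R.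
Proof.
have monU : lmul_mon U_(j) (weylD i) = lmul_var j (weylD i).
  rewrite /lmul_mon; have: count_mem j (enum 'I_n) = 1%N.
    by rewrite count_uniq_mem ?enum_uniq // mem_enum.
  elim: (enum 'I_n) => //= x s IHs; rewrite mnm1E [x == j]eq_sym.
  case: eqVneq => [<- /= [/count_memPn js]|_ /= /IHs -> //].
  congr lmul_var; elim: s js {IHs} => //= y s IHs; rewrite inE negb_or.
  by case/andP=> njy /IHs ->; rewrite mnm1E (negPf njy).
have lmulX : weylC 'X_j * weylD i = lmul_var j (weylD i).
  rewrite -[RHS]monU [LHS]/(weyl_mul _ _) /weyl_mul msuppC.
  have /negPf -> : 'X_j != 0 :> {mpoly R[n]} by rewrite -msupp_eq0 msuppX.
  rewrite big_seq1 mcoeffC eqxx mulr1 mpolyX0 mul1r /lmul_poly msuppX big_seq1.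
  by rewrite mcoeffX eqxx mpolyC1 scale1r.
have mulD Q : weylD i * Q = 'X_i * Q :> {mpoly {mpoly R[n]}[n]}.
  rewrite [LHS]/(weyl_mul _ _) /weyl_mul msuppX big_seq1 mcoeffX eqxx.
  rewrite /lmul_poly msupp1 big_seq1 mcoeff1 eqxx mpolyC1 scale1r /lmul_mon.
  by congr (_ * _); elim: (enum 'I_n) => //= x s ->; rewrite mnm0E.
rewrite lmulX mulD /lmul_var mderivX mnm1E /weylC.
rewrite mulrC mul_mpolyC; case: eqVneq => [->|_]; last first.
  by rewrite scale0r subr0 addr0.
rewrite scale1r (_ : (U_(j) - U_(j))%MM = 0%MM) ?mpolyX0 ?subrK //.
by apply/mnmP=> l; rewrite mnmBE subnn mnm0E.
Qed.

(** Left action on polynomials: [∂^α P@_α] sends [s] to the [α]-th derivative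
    of [P@_α * s]. *)
Definition weyl_act (P : weyl R n) (s : {mpoly R[n]}) : {mpoly R[n]} :=
  \sum_(a <- msupp P) (P@_a * s)^`M[a].

End WeylTheory.

(** * Rational functions and power series in [t] *)

Definition Qt : fieldType := {fraction {poly rat}}.

Definition Qt_of_poly (a : {poly rat}) : Qt := FracField.tofrac a.

Definition Qt_of_rat (c : rat) : Qt := Qt_of_poly c%:P.

Definition Qt_t : Qt := Qt_of_poly 'X.

(** The derivation [d/dt], computed on a representative fraction. *)
Definition Qt_deriv (x : Qt) : Qt :=
  let num := \n_(repr x) in let den := \d_(repr x) in
  Qt_of_poly (num^`() * den - num * den^`()) / Qt_of_poly (den ^+ 2).

(** A power series in [Q[[t]]] is given by its sequence of coefficients. *)
Definition series := nat -> rat.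

Definition series_deriv (s : series) : series := fun n => n.+1%:R * s n.+1.

Definition poly_mul_series (a : {poly rat}) (s : series) : series :=
  fun n => \sum_(i < n.+1) a`_i * s (n - i)%N.

(** The operator [q_0 + q_1 ∂_t + ... + q_d ∂_t^d] annihilates the series [s].
    The value of the operator at [s] lives in [Q(t) ⊗_{Q[t]} Q[[t]]], the
    localization of [Q[[t]]] at the non-zero polynomials. This is torsion free
    over [Q[t]], so the value is zero if and only if it is zero after
    multiplication by a common denominator [b] of the [q_i]. *)
Definition annihilates (d : nat) (q : 'rV[Qt]_d.+1) (s : series) : Prop :=
  exists (b : {poly rat}) (a : 'I_d.+1 -> {poly rat}),
    [/\ b != 0, forall i, q 0 i = Qt_of_poly (a i) / Qt_of_poly b
      & forall n, \sum_(i < d.+1)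
          poly_mul_series (a i) (iter i series_deriv s) n = 0].

(** * Graph models and their scalar products *)

Variant edge_kind := SimpleEdges | MultipleEdges.

Variant loop_kind := Loopless | LoopsAllowed | LoopsHalf.

Record graph_model := GraphModel {
  edges : edge_kind;
  loops : loop_kind;
  degrees : {fset nat};
  degrees_neq0 : degrees != fset0;
  degrees_gt0 : 0%N \notin degrees }.

Definition maxdeg (gm : graph_model) : nat := \max_(j <- degrees gm) j.

(** [p_j], for [1 <= j <= k]; the variables ['X_i] are numbered from 0. *)
Definition pvar (k j : nat) : {mpoly rat[k]} :=
  if insub j.-1 is Some i then 'X_i else 0.

Definition edge_sign (e : edge_kind) (i : nat) : rat :=
  if e is SimpleEdges then (-1) ^+ i.+1 else 1.

Definition poly_f (gm : graph_model) : {mpoly rat[maxdeg gm]} :=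
  let k := maxdeg gm in
  let eps := edge_sign (edges gm) in
  let is_lh := if loops gm is LoopsHalf then 1 else 0 : rat in
  let is_la := if loops gm is LoopsAllowed then 1%N else 0%N in
  \sum_(1 <= i < k.+1)
      eps i *: ((2 * i)%N%:R^-1 *: pvar k i ^+ 2 + (is_lh / i%:R) *: pvar k i)
  - (-1) ^+ is_la *
    \sum_(1 <= i < k./2.+1) (eps i / (2 * i)%N%:R) *: pvar k (2 * i)%N.

(** A partition with parts at most [k] is encoded by its multiplicities: [m i]
    is the number of parts equal to [i.+1]. Then [p_lambda] is ['X_[m]], and
    [mnmwgt m] is the sum of the parts. *)
Definition zpart (k : nat) (m : 'X_{1..k}) : rat :=
  \prod_(i < k) (i.+1%:R ^+ m i * (m i)`!%:R).

(** A partition of [j] has at most [j] parts, whence the bound on the degree. *)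
Definition poly_g (gm : graph_model) : {mpoly rat[maxdeg gm]} :=
  \sum_(j <- degrees gm)
    \sum_(m : 'X_{1..(maxdeg gm) < j.+1} | mnmwgt m == j) (zpart m)^-1 *: 'X_[m].

(** Coefficients of [exp(f) ∈ Q[[p]]], for [f] without constant term: [f^n] has
    no monomial of degree less than [n]. *)
Definition exp_coef (k : nat) (f : {mpoly rat[k]}) (m : 'X_{1..k}) : rat :=
  \sum_(n < (mdeg m).+1) (f ^+ n)@_m / n`!%:R.

(** The scalar product of an element of [Q[[p]]], given by its coefficients,
    with a polynomial. *)
Definition scalar_product (k : nat) (a : 'X_{1..k} -> rat) (b : {mpoly rat[k]}) :=
  \sum_(m <- msupp b) a m * b@_m * zpart m.

(** [<exp(f), exp(tg)>], where [g^n / n!] is the coefficient of [t^n] in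
    [exp(tg)]. *)
Definition graph_series (gm : graph_model) : series := fun n =>
  scalar_product (exp_coef (poly_f gm)) (n`!%:R^-1 *: poly_g gm ^+ n).

(** * Monomial orderings *)

Section Orders.
Variable k : nat.
Implicit Types (le : rel 'X_{1..k}) (m : 'X_{1..k}).

Definition total_order le := [/\ antisymmetric le, transitive le & total le].

Definition monomial_order le :=
  [/\ total_order le, forall m, le 0%MM m
    & forall m m1 m2, le m1 m2 -> le (m + m1)%MM (m + m2)%MM].

Definition graded_order le :=
  monomial_order le /\ forall m1 m2, (mdeg m1 < mdeg m2)%N -> le m1 m2.

Definition is_lead_mon (R : comNzRingType) le (s : {mpoly R[k]}) m :=
  m \in msupp s /\ forall m', m' \in msupp s -> le m' m.

End Orders.

(** * The algorithm *)

Section Algorithm.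
Variable gm : graph_model.
Let k := maxdeg gm.
Local Notation A := {mpoly Qt[k]}.
Local Notation W := (weyl Qt k).
Local Notation mon := 'X_{1..k}.

Definition f_ : 'I_k -> {mpoly rat[k]} := fun i => (poly_f gm)^`M(i).

Definition Qtp (s : {mpoly rat[k]}) : A := map_mpoly Qt_of_rat s.

(** [p_i - i f_i(...)], where the variable [p_j] is substituted by [j (∂_j + t g_j)] in the
    Weyl algebra; [mmap] evaluates a polynomial at such non-commuting values. *)
Definition Psharp (i : 'I_k) : W :=
  weylC 'X_i - i.+1%:R *
    mmap (fun c : rat => weylC (Qt_of_rat c)%:MP)
      (fun j : 'I_k =>
         j.+1%:R * (weylD Qt j + weylC (Qt_t *: Qtp (poly_g gm)^`M(j))) : W)
      (f_ i).

(** The free right [Q(t)[p]]-module with basis [η_1] and the [∂^α η_0],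
    [α <> 0], is identified with (a submodule of) [W] by [η_1 = η_0 = 1]. So the
    component [η_1] is the one of index [α = 0], and a module monomial
    [∂^α η p^γ] is written [(α, γ)], with [η = η_1] if [α = 0], and [η = η_0]
    otherwise. *)
Definition in_submodule (v : W) : Prop :=
  exists a : 'I_k -> A, v = \sum_(i < k) Psharp i * weylC (a i).

(** The module ordering: elimination of [η_1], then [le_p] in each part; ties
    for the [∂^α η_0] are broken by [le_d]. *)
Definition mod_le (le_p le_d : rel mon) (x y : mon * mon) : bool :=
  let: (a, c) := x in let: (b, d) := y in
  if b == 0%MM then (a != 0%MM) || le_p c d
  else (a != 0%MM) && (if c == d then le_d a b else le_p c d).

Definition is_lead_mod (le_p le_d : rel mon) (v : W) (x : mon * mon) : Prop :=
  x.2 \in msupp v@_x.1 /\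
  forall y : mon * mon, y.2 \in msupp v@_y.1 -> mod_le le_p le_d y x.

Definition groebner (le_p le_d : rel mon) (B : seq W) : Prop :=
  (forall b, b \in B -> in_submodule b) /\
  forall v, in_submodule v -> v != 0 ->
    exists b x y, [/\ b \in B, is_lead_mod le_p le_d b x,
      is_lead_mod le_p le_d v y, x.1 = y.1 & (x.2 <= y.2)%MM].

(** The elements of the basis with non-zero [η_1]-coefficient. *)
Definition Gs (B : seq W) : seq W := [seq b <- B | b@_0%MM != 0].

Definition Qpart (G : W) : A := G@_0%MM.

(** Membership in the ideal generated by the [Qpart]s. *)
Definition in_I (B : seq W) (s : A) : Prop :=
  exists a : W -> A, s = \sum_(G <- Gs B) a G * Qpart G.

(** The Krull dimension of the quotient by [I] is positive. *)
Definition positive_dim (I : A -> Prop) : Prop :=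
  exists P0 P1 : {pred A},
    [/\ idealr_closed P0 /\ prime_idealr_closed P0,
        idealr_closed P1 /\ prime_idealr_closed P1,
        forall s, I s -> s \in P0, {subset P0 <= P1}
      & exists2 s, s \in P1 & s \notin P0].

Definition under_stairs (le_p : rel mon) (I : A -> Prop) (m : mon) : Prop :=
  ~ exists2 s, I s & is_lead_mon le_p s m.

(** [reduces le_p B s r]: some execution of [red(s)], for some choices of the
    index [j], terminates and returns [r]. *)
Definition reducible_by (le_p : rel mon) (B : seq W) (m : mon) : Prop :=
  exists G mG, [/\ G \in Gs B, is_lead_mon le_p (Qpart G) mG & (mG <= m)%MM].

Inductive reduces (le_p : rel mon) (B : seq W) : A -> A -> Prop :=
| reduces_done s of (forall m, m \in msupp s -> ~ reducible_by le_p B m) :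
    reduces le_p B s s
| reduces_step s r m G mG of
    m \in msupp s
    & (forall m', m' \in msupp s -> reducible_by le_p B m' -> le_p m' m)
    & G \in Gs B & is_lead_mon le_p (Qpart G) mG & (mG <= m)%MM
    & reduces le_p B
        (s - weyl_act G ((s@_m / (Qpart G)@_mG) *: 'X_[m - mG])) r :
    reduces le_p B s r.

(** The algorithm does not fail, and [M] is the matrix obtained for some
    choice of a Gröbner basis, some enumeration [beta] of the monomials under
    the stairs, and some terminating executions of [red]. *)
Definition computes_matrix (le_p le_d : rel mon) (d : nat)
    (M : 'M[Qt]_(d.+1, d)) : Prop :=
  exists (B : seq W) (beta : d.-tuple mon) (gc : nat -> A),
    [/\ groebner le_p le_d B /\ ~ positive_dim (in_I B),
        uniq beta /\ forall m, m \in beta <-> under_stairs le_p (in_I B) m,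
        gc 0%N = 1,
        forall i, (i < d)%N -> reduces le_p B
          (Qtp (poly_g gm) * gc i + map_mpoly Qt_deriv (gc i)) (gc i.+1)
      & M = \matrix_(i, j) (gc i)@_(tnth beta j)].

(** The number of zeros at the right end of a row vector. *)
Definition trailing_zeros (n : nat) (q : 'rV[Qt]_n) : nat :=
  find (predC1 0) (rev [seq q 0 j | j <- enum 'I_n]).

Definition kernel_choice (d : nat) (M : 'M[Qt]_(d.+1, d)) (q : 'rV[Qt]_d.+1) :=
  [/\ q != 0, q *m M = 0
    & forall q' : 'rV[Qt]_d.+1, q' != 0 -> q' *m M = 0 ->
        (trailing_zeros q' <= trailing_zeros q)%N].

(** [Operator q] stands for [q_0 + q_1 ∂_t + ... + q_d ∂_t^d]. *)
Variant outcome := Fail | Operator (d : nat) (q : 'rV[Qt]_d.+1).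

(** The outcomes of the terminating executions. *)
Variant returns (le_p le_d : rel mon) : outcome -> Prop :=
| returns_fail B of groebner le_p le_d B & positive_dim (in_I B) :
    returns le_p le_d Fail
| returns_operator d (M : 'M_(d.+1, d)) q of
    computes_matrix le_p le_d M & kernel_choice M q :
    returns le_p le_d (Operator q).

End Algorithm.

(* Main.v *)
Require Import Defs.
From HB Require Import structures.
From mathcomp Require Import all_boot all_order all_algebra ring.
From mathcomp.multinomials Require Import ssrcomplements mpoly.
From Stdlib Require Import Classical.

(** Consider the linear form [L(s) = <exp(f), s exp(tg)>]. The scalar product
    makes [p_i] adjoint to [i ∂_i], and [(∂_i + t g_i) s] times [exp(tg)] is
    [∂_i (s exp(tg))]; moving the operator to the left factor, [L(P_i^# s)] is
    [<i (∂_i - f_i) exp(f), s exp(tg)> = 0] ([scalar_product_adjoint],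
    [pairing_adjoint]). Hence [L(G s) = 0] for every [G] in the right submodule
    generated by the [P_i^#], so [red] does not change the value of [L]
    ([reduces_null]). Also [L(g s + ∂_t s) = ∂_t L(s)] ([pairing_deriv]). By
    induction [L] takes the value [∂_t^i S] at the [i]-th polynomial of step
    (g), and a linear relation between these polynomials is a differential
    equation for [S].

    A vector of the left kernel of [M] gives such a relation provided that all
    the monomials involved are under the stairs, since [M] records only these.
    For the values of [red], which are irreducible, it follows from the
    elimination property of the Gröbner basis: the polynomials [Q_i] form a
    Gröbner basis of [I] ([lead_mon_I_reducible]). For the initial polynomial 1,
    which is not a value of [red], it means that [I] is a proper ideal
    ([one_notin_I]); otherwise the matrix would have no column and the operator
    returned would be a non-zero constant, while [S] is not zero. Here the shape
    of [f] matters: [f_i] is an affine function of [p_i], so the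
    [η_1]-coefficient of [P_i^#] is [p_i - β_i t g_i - γ_i] with [β_i] and [γ_i]
    rational numbers, and [I] is contained in the ideal generated by these.
    They have a common zero in [Q[[t]]], the fixed point of a map that is
    contracting for the [t]-adic topology ([approximate_fixpoint]), hence they
    do not generate the unit ideal ([critical_proper]).

    Denominators in [t] are handled as follows. The form [L] is defined on
    [Q[p][t]] only ([pairing]). A polynomial over [Q(t)] is called null if some
    multiple of it by a non-zero element of [Q[t]] lies in [Q[p][t]] and in the
    kernel of [L]; the null polynomials are stable under [s |-> g s + ∂_t s]
    ([null_weighted_deriv]), so all the congruences of the proof take place
    modulo null polynomials. *)

Set Implicit Arguments.
Unset Strict Implicit.
Unset Printing Implicit Defensive.

Import GRing.Theory Num.Theory.
Local Open Scope ring_scope.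

(** * The scalar product with exp(f), and its adjunctions *)

Section SumOverSupport.
Variables (R : nzRingType) (n : nat) (V : zmodType) (F : 'X_{1..n} -> R -> V).
Hypothesis F_additive : forall m, {morph F m : x y / x - y}.

(** Both the scalar product with a fixed power series and the action of the Weyl
    algebra are sums of this form; additivity is not apparent, since the support
    of a sum depends on cancellations. *)
Definition sum_msupp (p : {mpoly R[n]}) : V := \sum_(m <- msupp p) F m p@_m.

Let F0 m : F m 0 = 0. Proof. by have := F_additive m 0 0; rewrite subr0 subrr. Qed.

Lemma sum_msupp_bounded d p : (msize p <= d)%N ->
  sum_msupp p = \sum_(m : 'X_{1..n < d}) F m p@_m.
Proof.
move=> le_pd; pose I : subFinType _ := 'X_{1..n < d}.
rewrite /sum_msupp (big_mksub I) ?msupp_uniq //=; first last.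
  by move=> x /msize_mdeg_lt /leq_trans; apply.
by rewrite big_rmcond //= => j /memN_msupp_eq0 ->.
Qed.

Lemma sum_msuppB : {morph sum_msupp : p q / p - q}.
Proof.
move=> p q; set d := maxn (msize (p - q)) (maxn (msize p) (msize q)).
rewrite !(@sum_msupp_bounded d) ?leq_max ?leqnn ?orbT // -sumrB.
by apply: eq_bigr => m _; rewrite mcoeffB F_additive.
Qed.

Lemma sum_msuppCX c m : sum_msupp (c *: 'X_[m]) = F m c.
Proof.
rewrite (@sum_msupp_bounded (mdeg m).+1); last first.
  by rewrite (leq_trans (msizeZ_le _ _)) ?msizeX.
rewrite (bigD1 (BMultinom (ltnSn (mdeg m)))) //= mcoeffZ mcoeffX eqxx mulr1.
rewrite big1 ?addr0 // => m' ne; rewrite mcoeffZ mcoeffX.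
have [e|_] := eqVneq m m'; last by rewrite mulr0 F0.
by case/eqP: ne; apply: val_inj; rewrite /= -e.
Qed.

End SumOverSupport.

Section ScalarProduct.
Variables (k : nat) (a : 'X_{1..k} -> rat).

Let spF (m : 'X_{1..k}) (c : rat) : rat := a m * c * zpart m.

Lemma spF_additive m : {morph spF m : x y / x - y}.
Proof. by move=> x y; rewrite /spF mulrBr mulrBl. Qed.

Lemma scalar_product_is_additive : zmod_morphism (scalar_product a).
Proof. exact: (sum_msuppB spF_additive). Qed.

HB.instance Definition _ := GRing.isZmodMorphism.Build {mpoly rat[k]} rat
  (scalar_product a) scalar_product_is_additive.

Lemma scalar_productX c m : scalar_product a (c *: 'X_[m]) = a m * c * zpart m.
Proof. exact: (sum_msuppCX spF_additive). Qed.

Lemma scalar_productZ c p : scalar_product a (c *: p) = c * scalar_product a p.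
Proof.
rewrite [p]mpolyE scaler_sumr !raddf_sum mulr_sumr; apply: eq_bigr => m _.
by rewrite /= scalerA !scalar_productX; ring.
Qed.

End ScalarProduct.

(** This relation between the [z_λ] is the adjunction of [p_i] and [i ∂_i] on
    monomials. *)
Lemma zpartDU k (m : 'X_{1..k}) i :
  zpart (m + U_(i))%MM = i.+1%:R * (m i).+1%:R * zpart m.
Proof.
rewrite /zpart !(bigD1 (P := predT) i) //= mnmDE mnm1E eqxx addn1 exprS factS natrM.
rewrite (eq_bigr (fun j : 'I_k => j.+1%:R ^+ m j * (m j)`!%:R)); first by ring.
by move=> j ji; rewrite mnmDE mnm1E eq_sym (negPf ji) addn0.
Qed.

Section ExpSeries.
Variables (k : nat) (f : {mpoly rat[k]}).
Hypothesis f0 : f@_0%MM = 0.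

Lemma mcoeff_exp_small n m : (mdeg m < n)%N -> (f ^+ n)@_m = 0.
Proof.
elim: n m => // n IHn m lt_mn; rewrite exprS mcoeffM big1 // => -[m1 m2] /= /eqP mE.
have [->|m1_neq0] := eqVneq (val m1) 0%MM; first by rewrite f0 mul0r.
rewrite [X in _ * X]IHn ?mulr0 //.
rewrite -ltnS; apply: leq_trans lt_mn; rewrite ltnS [X in (_ < mdeg X)%N]mE mdegD.
by rewrite -add1n leq_add2r lt0n mdeg_eq0.
Qed.

Lemma mderivXn n i : (f ^+ n)^`M(i) = (f ^+ n.-1 * f^`M(i)) *+ n.
Proof.
elim: n => [|n IHn]; first by rewrite expr0 -mpolyC1 mderivC.
rewrite exprS mderivM IHn mulrnAr mulrA -[n.+1.-1]/n.
case: n {IHn} => [|n]; first by rewrite !mulr0n !expr0; ring.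
by rewrite /= -exprS [f^`M(i) * _]mulrC -mulrS.
Qed.

(** The coefficients of [∂_i exp(f) = f_i exp(f)]. When [f_i] is affine in [p_i]
    alone, only three coefficients of [exp(f)] are involved. *)
Lemma exp_coef_deriv (i : 'I_k) alpha kappa (m : 'X_{1..k}) :
  f^`M(i) = alpha *: 'X_i + kappa%:MP ->
  (m i).+1%:R * exp_coef f (m + U_(i)) =
    alpha * (if m i == 0%N then 0 else exp_coef f (m - U_(i))%MM)
    + kappa * exp_coef f m.
Proof.
move=> fi.
(* The terms of degree [n.+1] in [f] on the left match those of degree [n] on the
   right; the term of degree 0 on the left has derivative zero. *)
have term n : (m i).+1%:R * ((f ^+ n.+1)@_(m + U_(i)) / n.+1`!%:R) =
    (f ^+ n * f^`M(i))@_m / n`!%:R.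
  rewrite mulrA [_ * _@__]mulrC mulr_natr -mcoeff_deriv mderivXn mcoeffMn /=.
  rewrite factS natrM -mulr_natr; field.
  by rewrite -[1]/(1%:R) -natrD !pnatr_eq0 -lt0n fact_gt0.
have -> : (m i).+1%:R * exp_coef f (m + U_(i)) =
    \sum_(n < (mdeg m).+1) (f ^+ n * f^`M(i))@_m / n`!%:R.
  rewrite /exp_coef mdegD mdeg1 addn1 big_ord_recl /= expr0 mcoeff1.
  have -> : (m + U_(i))%MM == 0%MM = false.
    by apply/negP => /eqP/mnmP/(_ i); rewrite mnmDE mnm1E eqxx addn1 mnm0E.
  by rewrite mul0r add0r mulr_sumr; apply: eq_bigr => n _; rewrite /bump /= add1n term.
have -> : \sum_(n < (mdeg m).+1) (f ^+ n * f^`M(i))@_m / n`!%:R =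
    alpha * (\sum_(n < (mdeg m).+1) (f ^+ n * 'X_i)@_m / n`!%:R) + kappa * exp_coef f m.
  rewrite /exp_coef !mulr_sumr -big_split; apply: eq_bigr => n _ /=.
  by rewrite fi mulrDr -scalerAr [_ * _%:MP]mulrC mcoeffD mcoeffZ mcoeffCM; ring.
congr (_ * _ + _); have [mi0|mi_neq0] := eqVneq (m i) 0%N.
  rewrite big1 // => n _; rewrite memN_msupp_eq0 ?mul0r //.
  rewrite (perm_mem (msuppMX _ _)); apply/mapP => -[m' _ /mnmP/(_ i)].
  by rewrite mnmDE mnm1E eqxx mi0.
have mE : (m - U_(i) + U_(i))%MM = m by rewrite submK // lep1mP.
rewrite -[in LHS]mE mdegD mdeg1 addn1 big_ord_recr /=.
have coefMX n : (f ^+ n * 'X_i)@_(m - U_(i) + U_(i)) = (f ^+ n)@_(m - U_(i)).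
  by rewrite addmC mcoeffMX.
(* The left sum has one more term, which vanishes because the power exceeds the
   degree of the monomial. *)
rewrite coefMX mcoeff_exp_small ?ltnSn // mul0r addr0.
by apply: eq_bigr => n _; rewrite coefMX.
Qed.

(** Moving [p_i] to the left factor gives [i ∂_i exp(f) = i f_i exp(f)], and the
    factor [p_i] in [f_i] goes back to the right as [i ∂_i]. *)
Lemma scalar_product_adjoint (i : 'I_k) alpha kappa p :
  f^`M(i) = alpha *: 'X_i + kappa%:MP ->
  scalar_product (exp_coef f) ('X_i * p) =
    (i.+1%:R * alpha) * scalar_product (exp_coef f) (i.+1%:R *: p^`M(i))
    + (i.+1%:R * kappa) * scalar_product (exp_coef f) p.
Proof.
move=> fi; rewrite -mderivZ [p]mpolyE mulr_sumr scaler_sumr (raddf_sum (mderiv i)).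
rewrite !raddf_sum !mulr_sumr.
rewrite -big_split; apply: eq_bigr => m _ /=.
rewrite -scalerAr -mpolyXD [X in mpolyX _ X]addmC !mderivZ mderivX !scalerA.
rewrite !scalar_productX zpartDU.
have -> (x y : rat) : x * p@_m * (y * (m i).+1%:R * zpart m) =
    p@_m * y * zpart m * ((m i).+1%:R * x) by ring.
rewrite (exp_coef_deriv m fi); have [->|mi_neq0] := eqVneq (m i) 0%N; first by ring.
have mE : (m - U_(i) + U_(i))%MM = m by rewrite submK // lep1mP.
have -> : zpart m = i.+1%:R * (m i)%:R * zpart (m - U_(i))%MM.
  by rewrite -{1}mE zpartDU mnmBE mnm1E eqxx subn1 prednK ?lt0n.
ring.
Qed.
End ExpSeries.

(** * The pairing with exp(f) and exp(tg) *)

Section Pairing.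
Variables (k : nat) (f g : {mpoly rat[k]}).
Local Notation P := {mpoly rat[k]}.
Local Notation ell := (scalar_product (exp_coef f)).
Implicit Types s : {poly P}.

Definition exp_trunc N : {poly P} := \poly_(n < N) ((n`!%:R)^-1 *: g ^+ n).

(** The series [<exp(f), s exp(tg)>] for [s] in [Q[p][t]]. Its coefficient at [t^n]
    depends only on the truncation of [exp(tg)] at order [n], so that it can be
    computed with a polynomial. *)
Definition pairing s : series := fun n => ell (s * exp_trunc n.+1)`_n.

Lemma pairing_trunc N s n : (n < N)%N -> pairing s n = ell (s * exp_trunc N)`_n.
Proof.
move=> lt_nN; rewrite /pairing !coefM; congr ell; apply: eq_bigr => j _.
rewrite !coef_poly ltnS leq_subr (leq_ltn_trans _ lt_nN) //.
exact: leq_subr.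
Qed.

Lemma pairing1 n : pairing 1 n = ell (n`!%:R^-1 *: g ^+ n).
Proof. by rewrite /pairing mul1r coef_poly ltnSn. Qed.

Lemma pairingD s1 s2 n : pairing (s1 + s2) n = pairing s1 n + pairing s2 n.
Proof. by rewrite /pairing mulrDl coefD raddfD. Qed.

Lemma pairingB s1 s2 n : pairing (s1 - s2) n = pairing s1 n - pairing s2 n.
Proof. by rewrite /pairing mulrBl coefB raddfB. Qed.

Lemma pairing0 n : pairing 0 n = 0.
Proof. by rewrite /pairing mul0r coef0 raddf0. Qed.

Definition const_p (a : {poly rat}) : {poly P} := map_poly (@mpolyC k rat) a.

Lemma pairing_mul_const a s n :
  pairing (const_p a * s) n = poly_mul_series a (pairing s) n.
Proof.
rewrite /pairing -mulrA coefM raddf_sum; apply: eq_bigr => j _ /=.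
rewrite coef_map /= mul_mpolyC scalar_productZ -pairing_trunc //.
by rewrite ltnS leq_subr.
Qed.

Lemma pairing_mul_rat c s n : pairing (c%:MP%:P * s) n = c * pairing s n.
Proof. by rewrite /pairing -mulrA coefCM mul_mpolyC scalar_productZ. Qed.

(** The derivative of [s exp(tg)] with respect to [t] is [(g s + ∂_t s) exp(tg)]. *)
Lemma pairing_deriv s n :
  pairing (g%:P * s + s^`()) n = series_deriv (pairing s) n.
Proof.
rewrite /series_deriv !(@pairing_trunc n.+2) // mulr_natl -raddfMn -coef_deriv derivM.
congr ell; rewrite mulrDl !coefD addrC; congr (_ + _).
rewrite [g%:P * s]mulrC -mulrA !coefM.
apply: eq_bigr => j _; congr (_ * _).
rewrite coefCM coef_deriv !coef_poly.
have lej : (n - j <= n)%N := leq_subr _ _.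
rewrite !ltnS lej (leq_trans lej) //.
rewrite -scalerAr -exprS scalerMnl; congr (_ *: _).
rewrite factS natrM -mulr_natr; field.
by rewrite -[1]/(1%:R) -natrD !pnatr_eq0 -lt0n fact_gt0.
Qed.

Lemma map_mderivM i (s1 s2 : {poly P}) :
  map_poly (mderiv i) (s1 * s2) =
    map_poly (mderiv i) s1 * s2 + s1 * map_poly (mderiv i) s2.
Proof.
apply/polyP => n; rewrite coef_map coefD !coefM raddf_sum -big_split.
by apply: eq_bigr => j _; rewrite /= !coef_map /= mderivM.
Qed.

(** The identity [L(P_i^# s) = 0], from the adjunction applied to [s exp(tg)], whose
    derivative with respect to [p_i] is [(∂_i s + t g_i s) exp(tg)]. *)
Lemma pairing_adjoint (f0 : f@_0%MM = 0) i alpha kappa s n :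
  f^`M(i) = alpha *: 'X_i + kappa%:MP ->
  pairing (('X_i)%:P * s) n =
    pairing ((i.+1%:R * alpha * i.+1%:R)%:MP%:P *
        (map_poly (mderiv i) s + 'X * ((g^`M(i))%:P * s))
      + (i.+1%:R * kappa)%:MP%:P * s) n.
Proof.
move=> fi.
have exp_diff j : (j <= n)%N ->
    (map_poly (mderiv i) (exp_trunc n.+1))`_j =
      ('X * ((g^`M(i))%:P * exp_trunc n.+1))`_j.
  move=> le_jn; rewrite coef_map coefXM coefCM !coef_poly ltnS le_jn /=.
  rewrite mderivZ mderivXn.
  case: j le_jn => [|j] lt_jn /=; first by rewrite mulr0n scaler0.
  rewrite (leqW lt_jn) -scalerAr [g^`M(i) * _]mulrC -scalerMnr scalerMnl.
  congr (_ *: _).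
  rewrite factS natrM -mulr_natr; field.
  by rewrite -[1]/(1%:R) -natrD !pnatr_eq0 -lt0n fact_gt0.
have -> : pairing (('X_i)%:P * s) n = ell ('X_i * (s * exp_trunc n.+1)`_n).
  by rewrite /pairing -mulrA coefCM.
rewrite pairingD !pairing_mul_rat.
rewrite (scalar_product_adjoint f0 _ fi) scalar_productZ.
congr (_ + _); rewrite [LHS]mulrA /pairing; congr (_ * _); congr (ell _).
rewrite -[_^`M(i)](coef_map (mderiv i)) map_mderivM mulrDl !coefD; congr (_ + _).
have -> : 'X * (g^`M(i)%:P * s) * exp_trunc n.+1 =
    s * ('X * (g^`M(i)%:P * exp_trunc n.+1)).
  by rewrite [g^`M(i)%:P * s]mulrC mulrCA -!mulrA.
by rewrite !coefM; apply: eq_bigr => j _; rewrite exp_diff ?leq_subr.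
Qed.
End Pairing.

(** * Rational functions in t and denominators *)

HB.instance Definition _ := GRing.RMorphism.copy Qt_of_poly
  (@FracField.tofrac {poly rat}).
HB.instance Definition _ := GRing.RMorphism.copy Qt_of_rat (Qt_of_poly \o polyC).

Lemma Qt_of_polyM a b : Qt_of_poly (a * b) = Qt_of_poly a * Qt_of_poly b.
Proof. exact: rmorphM. Qed.

Lemma Qt_of_poly_inj : injective Qt_of_poly.
Proof. by move=> a b /eqP; rewrite /Qt_of_poly tofrac_eq => /eqP. Qed.

Lemma Qt_of_poly_eq0 a : (Qt_of_poly a == 0) = (a == 0).
Proof. exact: tofrac_eq0. Qed.

Lemma Qt_numden (x : Qt) : x * Qt_of_poly \d_(repr x) = Qt_of_poly \n_(repr x).
Proof.
rewrite -{1}[x]reprK /Qt_of_poly; unlock FracField.tofrac.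
rewrite -[LHS](FracField.pi_mul); apply/eqmodP.
rewrite /= FracField.equivfE /FracField.mulf.
rewrite !numden_Ratio ?oner_neq0 ?mulr1 ?denom_ratioP //.
by rewrite mulrC.
Qed.

Lemma Qt_frac (x : Qt) : exists a b, b != 0 /\ x = Qt_of_poly a / Qt_of_poly b.
Proof.
exists \n_(repr x), \d_(repr x); rewrite denom_ratioP; split=> //.
by rewrite -Qt_numden mulfK // Qt_of_poly_eq0 denom_ratioP.
Qed.

Lemma common_denominator (I : finType) (x : I -> Qt) : exists b (a : I -> {poly rat}),
  b != 0 /\ forall i, x i = Qt_of_poly (a i) / Qt_of_poly b.
Proof.
pose d i := \d_(repr (x i)); have d0 i : d i != 0 by exact: denom_ratioP.
have b0 : \prod_i d i != 0 by apply/prodf_neq0 => i _.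
exists (\prod_i d i), (fun i => \n_(repr (x i)) * \prod_(j | j != i) d j); split=> // i.
rewrite Qt_of_polyM -Qt_numden -[x i * _ * _]mulrA -Qt_of_polyM -/(d i).
have -> : d i * \prod_(j | j != i) d j = \prod_j d j by rewrite [RHS](bigD1 i).
by rewrite mulfK // Qt_of_poly_eq0.
Qed.

(** The quotient rule for an arbitrary fraction, not only for the representative
    used in the definition; stated without division so that it serves for
    coefficients known up to a denominator. *)
Lemma Qt_deriv_frac a b (x : Qt) : b != 0 -> x * Qt_of_poly b = Qt_of_poly a ->
  Qt_deriv x * Qt_of_poly (b ^+ 2) = Qt_of_poly (a^`() * b - a * b^`()).
Proof.
move=> b0 xE; rewrite /Qt_deriv; set n := \n_ _; set d := \d_ _.
have d0 : d != 0 by exact: denom_ratioP.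
have e : n * b = a * d.
  apply: Qt_of_poly_inj; rewrite !rmorphM /= -xE.
  by rewrite -[Qt_of_poly n]/(Qt_of_poly \n_(repr x)) -Qt_numden mulrAC.
have d20 : Qt_of_poly (d ^+ 2) != 0 by rewrite Qt_of_poly_eq0 expf_neq0.
rewrite mulrAC; apply: (canLR (mulfK d20)); rewrite -!rmorphM; congr Qt_of_poly.
have e' : n^`() * b + n * b^`() = a^`() * d + a * d^`() by rewrite -!derivM e.
have -> : (n^`() * d - n * d^`()) * b ^+ 2 =
  d * b * (n^`() * b + n * b^`()) - d * b^`() * (n * b) - b * d^`() * (n * b) by ring.
by rewrite e' e; ring.
Qed.

Lemma Qt_deriv_frac_mul a b c (x : Qt) : b != 0 -> x * Qt_of_poly b = Qt_of_poly a ->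
  Qt_deriv x * Qt_of_poly (b ^+ 2 * c) = Qt_of_poly ((a^`() * b - a * b^`()) * c).
Proof.
by move=> b0 xE; rewrite !Qt_of_polyM -(Qt_deriv_frac b0 xE) Qt_of_polyM !mulrA.
Qed.

Lemma frac_subr (F : fieldType) (a b c d : F) : b != 0 -> d != 0 ->
  (a / b - c / d) * (b * d) = a * d - c * b.
Proof. by move=> b0 d0; field; rewrite d0. Qed.

Lemma Qt_deriv_is_additive : zmod_morphism Qt_deriv.
Proof.
move=> x y; have [a [b [b0 ->]]] := Qt_frac x; have [c [d [d0 ->]]] := Qt_frac y.
have bd0 : b * d != 0 by rewrite mulf_neq0.
have nz e : e != 0 -> Qt_of_poly e != 0 by rewrite Qt_of_poly_eq0.
have den : Qt_of_poly ((b * d) ^+ 2) != 0 by rewrite nz ?expf_neq0.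
apply: (mulIf den).
rewrite (Qt_deriv_frac (a := a * d - c * b)) //; last first.
  by rewrite rmorphB !rmorphM /= frac_subr ?nz.
have dx : Qt_deriv (Qt_of_poly a / Qt_of_poly b) * Qt_of_poly ((b * d) ^+ 2) =
    Qt_of_poly ((a^`() * b - a * b^`()) * d ^+ 2).
  by rewrite exprMn; apply: Qt_deriv_frac_mul; rewrite ?divfK ?nz.
have dy : Qt_deriv (Qt_of_poly c / Qt_of_poly d) * Qt_of_poly ((b * d) ^+ 2) =
    Qt_of_poly ((c^`() * d - c * d^`()) * b ^+ 2).
  by rewrite exprMn [b ^+ 2 * _]mulrC; apply: Qt_deriv_frac_mul; rewrite ?divfK ?nz.
rewrite [RHS]mulrBl.
apply: etrans _ (congr2 (fun u v : Qt => u - v) (esym dx) (esym dy)).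
by rewrite /= -rmorphB; congr Qt_of_poly; rewrite !derivE; ring.
Qed.

HB.instance Definition _ := GRing.isZmodMorphism.Build Qt Qt Qt_deriv
  Qt_deriv_is_additive.

Section Embedding.
Variable k : nat.
Local Notation P := {mpoly rat[k]}.
Local Notation A := {mpoly Qt[k]}.

Definition embed (s : {poly P}) : A :=
  (map_poly (map_mpoly Qt_of_rat) s).[Qt_t%:MP].

HB.instance Definition _ := GRing.RMorphism.copy embed
  (horner_eval (Qt_t%:MP : A) \o map_poly (map_mpoly Qt_of_rat)).

Lemma embedC p : embed p%:P = map_mpoly Qt_of_rat p.
Proof. by rewrite /embed map_polyC hornerC. Qed.

Lemma embedX : embed 'X = Qt_t%:MP.
Proof. by rewrite /embed map_polyX hornerX. Qed.

Lemma mcoeff_embed s m : (embed s)@_m = Qt_of_poly (map_poly (mcoeff m) s).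
Proof.
elim/poly_ind: s => [|s c IHs].
  by rewrite raddf0 (raddf0 (map_poly _)) rmorph0 mcoeff0.
have -> : map_poly (mcoeff m) (s * 'X + c%:P) = map_poly (mcoeff m) s * 'X + (c@_m)%:P.
  apply/polyP=> j; rewrite coef_map !coefD !coefMX !coefC raddfD /=.
  by case: j => [|j] /=; rewrite ?coef_map ?mcoeff0.
rewrite !rmorphD !rmorphM /= embedX embedC mulrC mcoeffD mcoeffCM IHs.
by rewrite mcoeff_map_mpoly mulrC.
Qed.

Lemma embed_inj : injective embed.
Proof.
move=> s1 s2 /mpolyP e; apply/polyP=> j; apply/mpolyP=> m.
have em := etrans (esym (mcoeff_embed s1 m)) (etrans (e m) (mcoeff_embed s2 m)).
have := congr1 (fun a : {poly rat} => a`_j) (Qt_of_poly_inj em).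
by rewrite /= !coef_map.
Qed.

Lemma embedD s1 s2 : embed (s1 + s2) = embed s1 + embed s2.
Proof. exact: rmorphD. Qed.

Lemma embedB s1 s2 : embed (s1 - s2) = embed s1 - embed s2.
Proof. exact: rmorphB. Qed.

Lemma embed_mulC p s : embed (p%:P * s) = map_mpoly Qt_of_rat p * embed s.
Proof. by rewrite rmorphM /= embedC. Qed.

Lemma embed_mulX s : embed ('X * s) = Qt_t *: embed s.
Proof. by rewrite rmorphM /= embedX mul_mpolyC. Qed.

Lemma map_mcoeff_const_mul m a (s : {poly P}) :
  map_poly (mcoeff m) (const_p k a * s) = a * map_poly (mcoeff m) s.
Proof.
apply/polyP=> j; rewrite coef_map !coefM raddf_sum; apply: eq_bigr => l _ /=.
by rewrite !coef_map /= mcoeffCM.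
Qed.

Lemma embed_const a : embed (const_p k a) = (Qt_of_poly a)%:MP.
Proof.
apply/mpolyP=> m; rewrite mcoeff_embed mcoeffC.
rewrite -[const_p k a]mulr1 map_mcoeff_const_mul -polyC1 map_polyC /= mcoeff1.
by rewrite rmorphM /= polyC_natr rmorph_nat.
Qed.

Lemma embed_const_mul a s : embed (const_p k a * s) = Qt_of_poly a *: embed s.
Proof. by rewrite rmorphM /= embed_const mul_mpolyC. Qed.

Lemma embed_mderiv i s : (embed s)^`M(i) = embed (map_poly (mderiv i) s).
Proof.
apply/mpolyP=> m; rewrite mcoeff_deriv !mcoeff_embed -rmorphMn; congr Qt_of_poly.
by apply/polyP=> j; rewrite coefMn !coef_map /= mcoeff_deriv.
Qed.

(** The shape shared by the identity of [pairing_adjoint] and the action of [P_i^#]. *)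
Lemma embed_adjoint_relation (x c1 c2 h : P) i s :
  embed (x%:P * s - (c1%:P * (map_poly (mderiv i) s + 'X * (h%:P * s)) + c2%:P * s)) =
    map_mpoly Qt_of_rat x * embed s
    - map_mpoly Qt_of_rat c1 *
        ((embed s)^`M(i) + Qt_t *: (map_mpoly Qt_of_rat h * embed s))
    - map_mpoly Qt_of_rat c2 * embed s.
Proof.
have embed_sub3 a b c : embed (a - (b + c)) = embed a - embed b - embed c.
  by rewrite embedB embedD opprD addrA.
rewrite embed_sub3; congr (_ - _ - _); [exact: embed_mulC | | exact: embed_mulC].
rewrite embed_mulC embedD embed_mderiv; congr (_ * (_ + _)).
by rewrite embed_mulX embed_mulC.
Qed.

Lemma clear_denominators (s : A) :
  exists b s', b != 0 /\ Qt_of_poly b *: s = embed s'.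
Proof.
elim/mpolyind: s => [|c m s _ _ [b [s' [b0 e]]]].
  by exists 1, 0; rewrite oner_neq0 rmorph1 rmorph0 scaler0.
have [u [v [v0 ->]]] := Qt_frac c.
exists (v * b), (const_p k (u * b) * 'X_[m]%:P + const_p k v * s'); split.
  by rewrite mulf_neq0.
rewrite rmorphD !rmorphM /= embedC map_mpolyX !embed_const !Qt_of_polyM !mul_mpolyC.
rewrite -e scalerDr !scalerA; congr (_ *: _ + _).
by rewrite mulrAC mulrCA divff ?Qt_of_poly_eq0 // mulr1.
Qed.

(** With [s = s' / b], the derivative is [(b ∂_t s' - b' s') / b^2]. *)
Lemma embed_deriv (s : A) b s' : b != 0 -> Qt_of_poly b *: s = embed s' ->
  Qt_of_poly (b ^+ 2) *: map_mpoly Qt_deriv s =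
    embed (const_p k b * s'^`() - const_p k b^`() * s').
Proof.
move=> b0 /mpolyP e; apply/mpolyP=> m.
rewrite mcoeffZ mcoeff_map_mpoly mcoeff_embed mulrC.
have := e m; rewrite mcoeffZ mcoeff_embed [_ * s@_m]mulrC => em.
rewrite (Qt_deriv_frac b0 em).
have -> : map_poly (mcoeff m) (const_p k b * s'^`() - const_p k b^`() * s') =
    b * (map_poly (mcoeff m) s')^`() - b^`() * map_poly (mcoeff m) s'.
  rewrite raddfB /= !map_mcoeff_const_mul; congr (_ * _ - _).
  by apply/polyP=> j; rewrite coef_map !coef_deriv coef_map /= mcoeffMn.
by rewrite mulrC [_ * b^`()]mulrC.
Qed.

End Embedding.

(** * Polynomials on which the pairing vanishes *)

Section Null.
Variables (k : nat) (f g : {mpoly rat[k]}).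
Local Notation P := {mpoly rat[k]}.
Local Notation A := {mpoly Qt[k]}.
Local Notation pg := (pairing f g).

(** The kernel of the extension of the pairing to [Q(t)[p]], with values in the
    localization of [Q[[t]]] at the non-zero polynomials. *)
Definition null (s : A) : Prop := exists b s',
  [/\ b != 0, Qt_of_poly b *: s = embed s' & pg s' =1 fun=> 0].

Lemma pairing_const_mul0 a s : pg s =1 (fun=> 0) -> pg (const_p k a * s) =1 fun=> 0.
Proof.
move=> s0 n; rewrite pairing_mul_const /poly_mul_series big1 // => j _.
by rewrite s0 mulr0.
Qed.

Lemma null0 : null 0.
Proof.
by exists 1, 0; split=> [||n]; rewrite ?oner_neq0 ?scaler0 ?rmorph0 ?pairing0.
Qed.

Lemma nullD s1 s2 : null s1 -> null s2 -> null (s1 + s2).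
Proof.
move=> [b1 [s1' [b10 e1 z1]]] [b2 [s2' [b20 e2 z2]]].
exists (b1 * b2), (const_p k b2 * s1' + const_p k b1 * s2').
split=> [||n]; last by rewrite pairingD !pairing_const_mul0 ?addr0.
  by rewrite mulf_neq0.
rewrite rmorphD !rmorphM /= !embed_const -e1 -e2 !mul_mpolyC !scalerA scalerDr.
by rewrite [Qt_of_poly b2 * _]mulrC.
Qed.

Lemma nullZ c s : null s -> null (c *: s).
Proof.
move=> [b [s' [b0 e z]]]; have [u [v [v0 ->]]] := Qt_frac c.
exists (b * v), (const_p k u * s'); split; first by rewrite mulf_neq0.
  rewrite Qt_of_polyM rmorphM /= embed_const mul_mpolyC -e !scalerA; congr (_ *: _).
  by rewrite mulrACA divff ?Qt_of_poly_eq0 // mulr1 mulrC.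
exact: pairing_const_mul0.
Qed.

Lemma null_sum (I : Type) (r : seq I) (Q : pred I) (F : I -> A) :
  (forall i, Q i -> null (F i)) -> null (\sum_(i <- r | Q i) F i).
Proof. by move=> F0; elim/big_rec: _ => [|i x Qi]; [exact: null0 | apply/nullD/F0]. Qed.

Definition weighted_deriv (s : A) : A :=
  map_mpoly Qt_of_rat g * s + map_mpoly Qt_deriv s.

Lemma weighted_derivB : {morph weighted_deriv : s t / s - t}.
Proof. by move=> s t; rewrite /weighted_deriv raddfB mulrBr opprD addrACA. Qed.

Definition weighted_deriv_poly (s : {poly P}) : {poly P} := g%:P * s + s^`().

(** Clearing denominators as in [embed_deriv], the pairing with [g s + ∂_t s] is a
    combination of the pairing with [s'] and of its derivative. *)
Lemma null_weighted_deriv s : null s -> null (weighted_deriv s).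
Proof.
move=> [b [s' [b0 e z]]].
exists (b ^+ 2), (const_p k b * weighted_deriv_poly s' - const_p k b^`() * s').
split; first by rewrite expf_neq0.
  rewrite /weighted_deriv_poly mulrDr -addrA [RHS]rmorphD /= -(embed_deriv b0 e).
  rewrite /weighted_deriv !scalerDr; congr (_ + _).
  rewrite expr2 Qt_of_polyM !rmorphM /= embed_const embedC -e mul_mpolyC.
  by rewrite -scalerA !scalerAr.
move=> n; rewrite pairingB !pairing_const_mul0 ?subr0 // => j.
by rewrite pairing_deriv /series_deriv z mulr0.
Qed.

Lemma null_adjoint (f0 : f@_0%MM = 0) i alpha kappa s :
  f^`M(i) = alpha *: 'X_i + kappa%:MP ->
  null ('X_i * s - Qt_of_rat (i.+1%:R * alpha * i.+1%:R) *:
         (s^`M(i) + (Qt_t *: map_mpoly Qt_of_rat g^`M(i)) * s)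
    - Qt_of_rat (i.+1%:R * kappa) *: s).
Proof.
move=> fi; have [b [s' [b0 e]]] := clear_denominators s.
pose c1 := i.+1%:R * alpha * i.+1%:R; pose c2 := i.+1%:R * kappa.
have adj n : pg (('X_i)%:P * s') n =
    pg (c1%:MP%:P * (map_poly (mderiv i) s' + 'X * ((g^`M(i))%:P * s'))
      + c2%:MP%:P * s') n.
  exact: (pairing_adjoint g f0 s' n fi).
rewrite -/c1 -/c2; move: c1 c2 adj => c1 c2 adj.
exists b, (('X_i)%:P * s' -
    (c1%:MP%:P * (map_poly (mderiv i) s' + 'X * ((g^`M(i))%:P * s'))
      + c2%:MP%:P * s')); split; [exact: b0| |move=> n].
  rewrite embed_adjoint_relation -e map_mpolyX !map_mpolyC !mul_mpolyC mderivZ.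
  rewrite /= !scalerBr; congr (_ - _ - _); first by rewrite scalerAr.
    rewrite scalerA mulrC -scalerA scalerDr; congr (_ *: (_ + _)).
    by rewrite -scalerAl -scalerAr !scalerA mulrC.
  by rewrite !scalerA mulrC.
by rewrite pairingB adj subrr.
Qed.

Lemma embed_iter_weighted_deriv n :
  embed (iter n weighted_deriv_poly 1) = iter n weighted_deriv 1.
Proof.
elim: n => [|n IHn]; first exact: rmorph1.
rewrite !iterS -IHn; move: (iter n _ _) => s.
rewrite /weighted_deriv_poly embedD embed_mulC; congr (_ + _).
have e : Qt_of_poly 1 *: embed s = embed s by rewrite rmorph1 scale1r.
have := embed_deriv (oner_neq0 _) e.
rewrite expr1n rmorph1 scale1r -polyC1 derivC => ->; congr embed.
by rewrite /const_p rmorph0 mul0r subr0 map_polyC /= rmorph1 mul1r.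
Qed.

Lemma pairing_iter_weighted_deriv n :
  pg (iter n weighted_deriv_poly 1) =1 iter n series_deriv (pg 1).
Proof.
elim: n => [|n IHn] // m.
by rewrite iterS pairing_deriv iterS /series_deriv IHn.
Qed.

(** The [i]-th iterate is the [i]-th derivative of [exp(tg)] divided by [exp(tg)],
    so its pairing is the [i]-th derivative of [S]; the hypothesis says that the
    operator kills [S] after multiplication by some non-zero polynomial, which is
    absorbed in the common denominator. *)
Lemma null_annihilates d (q : 'rV[Qt]_d.+1) (S : series) : pg 1 =1 S ->
  null (\sum_i q 0 i *: iter i weighted_deriv 1) -> annihilates q S.
Proof.
move=> pS [b [s' [b0 e z]]]; have [v [u [v0 qE]]] := common_denominator (q 0).
exists (b * v), (fun i => b * u i); split.
- by rewrite mulf_neq0.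
- by move=> i; rewrite qE !Qt_of_polyM -mulf_div divff ?mul1r ?Qt_of_poly_eq0.
have lin : \sum_i const_p k (b * u i) * iter i weighted_deriv_poly 1 = const_p k v * s'.
  apply: embed_inj; rewrite embed_const_mul -e raddf_sum !scaler_sumr.
  apply: eq_bigr => i _ /=; rewrite embed_const_mul embed_iter_weighted_deriv !scalerA.
  congr (_ *: _); rewrite qE Qt_of_polyM [Qt_of_poly v * _]mulrC.
  by rewrite mulrACA divff ?Qt_of_poly_eq0 // mulr1.
move=> n; have := pairing_const_mul0 v z n; rewrite -lin.
have pair_sum : {morph pg ^~ n : a b / a + b} by move=> x y; exact: pairingD.
rewrite (big_morph _ pair_sum (pairing0 _ _ _)) /=.
apply: etrans; apply: eq_bigr => i _.
rewrite pairing_mul_const /poly_mul_series; apply: eq_bigr => j _; congr (_ * _).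
rewrite pairing_iter_weighted_deriv.
by elim: (i : nat) (n - j)%N => [|l IHl] m /=; rewrite ?pS // /series_deriv IHl.
Qed.
End Null.

(** * The critical ideal is proper *)

Section CriticalPoint.
Variables (k : nat) (h : 'I_k -> {mpoly rat[k]}) (beta gamma : 'I_k -> rat).
Local Notation P := {mpoly rat[k]}.
Local Notation A := {mpoly Qt[k]}.

Definition peval (x : 'I_k -> {poly rat}) : P -> {poly rat} := mmap polyC x.

HB.instance Definition _ x := GRing.RMorphism.copy (peval x) (mmap polyC x).

Lemma peval_congr (d : {poly rat}) x y p :
  (forall i, d %| x i - y i) -> d %| peval x p - peval y p.
Proof.
move=> dxy; rewrite /peval /mmap -sumrB; apply: (big_ind (fun a => d %| a)).
- exact: dvdp0.
- by move=> a b; apply: dvdp_add.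
move=> m _; rewrite -mulrBr; apply: dvdp_mull; rewrite /mmap1.
apply: (big_ind2 (fun a b => d %| a - b)) => [|a1 b1 a2 b2 d1 d2|i _].
- by rewrite subrr dvdp0.
- have -> : a1 * a2 - b1 * b2 = a1 * (a2 - b2) + b2 * (a1 - b1) by ring.
  by rewrite dvdp_add // dvdp_mull.
by rewrite subrXX dvdp_mulr.
Qed.

(** The zeros of [p_i - β_i t h_i(p) - γ_i] are the fixed points of this map. *)
Definition fixstep (x : 'I_k -> {poly rat}) (i : 'I_k) : {poly rat} :=
  (beta i)%:P * ('X * peval x (h i)) + (gamma i)%:P.

(** The factor [t] makes [fixstep] a contraction for the [t]-adic distance.
    Polynomial approximations of the fixed point suffice, as only divisibility by
    powers of [t] is used. *)
Lemma approximate_fixpoint n : exists x, forall i, 'X^n %| x i - fixstep x i.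
Proof.
exists (iter n fixstep (fun=> 0)); elim: n => [|n IHn] i; first by rewrite expr0 dvd1p.
rewrite iterS [X in X - _]/fixstep [X in _ - X]/fixstep.
set a := peval _ _; set b := peval _ _.
have -> : (beta i)%:P * ('X * a) + (gamma i)%:P -
      ((beta i)%:P * ('X * b) + (gamma i)%:P) =
    (beta i)%:P * ('X * (a - b)) by ring.
by rewrite exprS dvdp_mull // dvdp_mul2l ?polyX_eq0 // peval_congr.
Qed.

(** For [h_i = ∂g/∂p_i], and if no [β_i] is zero, these are up to factors the
    derivatives of [sum_i (p_i - γ_i)^2 / (2 β_i) - t g], whence the name. *)
Definition critical (i : 'I_k) : A :=
  'X_i - Qt_of_rat (beta i) *: (Qt_t *: map_mpoly Qt_of_rat (h i))
  - (Qt_of_rat (gamma i))%:MP.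

Definition critical_poly (i : 'I_k) : {poly P} :=
  ('X_i)%:P - ((beta i)%:MP%:P * ('X * (h i)%:P) + (gamma i)%:MP%:P).

Lemma embed_critical_poly i : embed (critical_poly i) = critical i.
Proof.
rewrite /critical_poly embedB embedD embedC map_mpolyX opprD addrA.
by rewrite embedC map_mpolyC embed_mulC embed_mulX embedC map_mpolyC mul_mpolyC.
Qed.

Definition pteval (x : 'I_k -> {poly rat}) (s : {poly P}) : {poly rat} :=
  (map_poly (peval x) s).['X].

HB.instance Definition _ x := GRing.RMorphism.copy (pteval x)
  (horner_eval ('X : {poly rat}) \o map_poly (peval x)).

Lemma ptevalC x p : pteval x p%:P = peval x p.
Proof. by rewrite /pteval map_polyC hornerC. Qed.

Lemma ptevalX x : pteval x 'X = 'X.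
Proof. by rewrite /pteval map_polyX hornerX. Qed.

Lemma pevalC x c : peval x c%:MP = c%:P.
Proof. exact: mmapC. Qed.

Lemma pevalX x i : peval x 'X_i = x i.
Proof. by rewrite /peval mmapX mmap1U. Qed.

Lemma pteval_critical_poly x i : pteval x (critical_poly i) = x i - fixstep x i.
Proof.
rewrite /critical_poly /fixstep rmorphB rmorphD /= ptevalC pevalX; congr (_ - (_ + _)).
  by rewrite !rmorphM /= !ptevalC ptevalX pevalC.
by rewrite ptevalC pevalC.
Qed.

Lemma pteval_const x b : pteval x (const_p k b) = b.
Proof.
rewrite /pteval /const_p -map_poly_comp.
have -> : map_poly (peval x \o @mpolyC k rat) b = map_poly polyC b.
  by apply: eq_map_poly => c /=; rewrite pevalC.
exact: comp_polyXr.
Qed.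

Lemma clear_denominators_fin (a : 'I_k -> A) : exists b (a' : 'I_k -> {poly P}),
  b != 0 /\ forall i, Qt_of_poly b *: a i = embed (a' i).
Proof.
have [d ad] := fin_all_exists (fun i => clear_denominators (a i)).
have [a' ada] := fin_all_exists ad.
exists (\prod_i d i), (fun i => const_p k (\prod_(j | j != i) d j) * a' i).
split=> [|i]; first by apply/prodf_neq0 => i _; case: (ada i).
have [_ e] := ada i; rewrite embed_const_mul -e scalerA -Qt_of_polyM mulrC.
by rewrite [in LHS](bigD1 i).
Qed.

(** After clearing denominators, a relation would express a non-zero [b(t)] by
    the polynomials [critical_poly]; evaluating at an approximate common zero shows
    that [t^n] divides [b], which is impossible when [n] exceeds the degree of [b]. *)
Lemma critical_proper (a : 'I_k -> A) : \sum_i a i * critical i <> 1.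
Proof.
have [b [a' [b0 aE]]] := clear_denominators_fin a => sum1.
have bE : const_p k b = \sum_i a' i * critical_poly i.
  apply: embed_inj; rewrite embed_const -[_%:MP]mulr1 -sum1 mul_mpolyC.
  rewrite scaler_sumr raddf_sum.
  by apply: eq_bigr => i _; rewrite scalerAl aE -embed_critical_poly -rmorphM.
have [x xP] := approximate_fixpoint (size b).
have : 'X^(size b) %| b.
  rewrite -{2}(pteval_const x b) bE raddf_sum; apply: (big_ind (fun c => _ %| c)).
  - exact: dvdp0.
  - by move=> c c'; apply: dvdp_add.
  by move=> i _; rewrite /= rmorphM /= pteval_critical_poly dvdp_mull.
by move/(dvdp_leq b0); rewrite size_polyXn ltnn.
Qed.

End CriticalPoint.

(** * The Weyl algebra: products and action *)

Section Weyl.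
Variables (R : comNzRingType) (n : nat).
Local Notation A := {mpoly R[n]}.
Local Notation W := (weyl R n).

Section Act.
Variable s : A.

Let term (a : 'X_{1..n}) (c : A) : A := (c * s)^`M[a].

Let term_additive a : {morph term a : c d / c - d}.
Proof. by move=> c d; rewrite /term mulrBl mderivmB. Qed.

Lemma weyl_actB (P Q : W) : weyl_act (P - Q) s = weyl_act P s - weyl_act Q s.
Proof. exact: (sum_msuppB term_additive). Qed.

Lemma weyl_actZX c a : weyl_act (c *: 'X_[a] : {mpoly A[n]}) s = (c * s)^`M[a].
Proof. exact: (sum_msuppCX term_additive). Qed.

Definition act_on (P : {mpoly A[n]}) : A := weyl_act P s.

Lemma act_on_is_additive : zmod_morphism act_on.
Proof. exact: weyl_actB. Qed.

HB.instance Definition _ := GRing.isZmodMorphism.Build {mpoly A[n]} A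
  act_on act_on_is_additive.

Lemma weyl_actC c : weyl_act (weylC c) s = c * s.
Proof.
have -> : weylC c = (c *: 'X_[0%MM] : {mpoly A[n]}).
  by rewrite mpolyX0 -mul_mpolyC mulr1.
by rewrite weyl_actZX mderivm0m.
Qed.

Lemma weyl_actD i : weyl_act (weylD R i) s = s^`M(i).
Proof.
have -> : weylD R i = (1 *: 'X_i : {mpoly A[n]}) by rewrite scale1r.
by rewrite weyl_actZX mul1r mderivmU1m.
Qed.
End Act.

Lemma weyl_actZ c (P : {mpoly A[n]}) s : weyl_act (c *: P) s = weyl_act P (c * s).
Proof.
rewrite -[LHS]/(act_on s _) -[RHS]/(act_on _ _) [P]mpolyE scaler_sumr !raddf_sum.
by apply: eq_bigr => a _; rewrite /= /act_on scalerA !weyl_actZX mulrAC mulrC mulrA.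
Qed.

Lemma weyl_act_const c (P : {mpoly A[n]}) s :
  weyl_act (c%:MP *: P) s = c *: weyl_act P s.
Proof.
change (act_on s (c%:MP *: P) = c *: act_on s P).
rewrite [P]mpolyE scaler_sumr !(raddf_sum (act_on s)) scaler_sumr.
apply: eq_bigr => a _; rewrite /= /act_on scalerA !weyl_actZX -mulrA mul_mpolyC.
by rewrite mderivmZ.
Qed.

Lemma lmul_polyC (c d : A) : lmul_poly c d%:MP = (c * d)%:MP.
Proof.
have mon m : lmul_mon m d%:MP = ('X_[m] * d)%:MP :> {mpoly A[n]}.
  rewrite /lmul_mon mpolyXE_id.
  have -> : \prod_(i < n) 'X_i ^+ m i = \prod_(i <- enum 'I_n) 'X_i ^+ m i :> A.
    by rewrite [RHS]big_enum.
  elim: (enum 'I_n) => [|i s IHs] /=; first by rewrite big_nil mul1r.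
  rewrite IHs big_cons; elim: (m i) => [|l IHl] /=; first by rewrite expr0 mul1r.
  by rewrite IHl /lmul_var mderivC subr0 exprS -!mulrA -mul_mpolyC -mpolyCM.
rewrite [in RHS](mpolyE c) mulr_suml raddf_sum; apply: eq_bigr => m _ /=.
by rewrite mon -[LHS]mul_mpolyC -mpolyCM -scalerAl mul_mpolyC.
Qed.

Lemma weyl_mulrC (P : W) (c : A) :
  P * weylC c = (c *: (P : {mpoly A[n]})) :> {mpoly A[n]}.
Proof.
rewrite [in RHS](mpolyE P) scaler_sumr; apply: eq_bigr => a _.
by rewrite lmul_polyC mulrC mul_mpolyC scalerA mulrC.
Qed.

(** Left multiplication by a polynomial differentiates with respect to [∂] as well,
    except for constants, which commute with everything. *)
Lemma weyl_mulCl c (P : W) :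
  weylC c%:MP * P = (c%:MP *: (P : {mpoly A[n]})) :> {mpoly A[n]}.
Proof.
rewrite [LHS]/(weyl_mul _ _) /weyl_mul /weylC msuppC mpolyC_eq0.
have [->|c0] := eqVneq c 0; first by rewrite big_nil mpolyC0 scale0r.
rewrite big_seq1 mcoeffC eqxx mulr1 mpolyX0 mul1r /lmul_poly msuppC (negPf c0).
rewrite big_seq1 mcoeffC eqxx mulr1; congr (_ *: _).
by rewrite /lmul_mon; elim: (enum 'I_n) => //= i s ->; rewrite mnm0E.
Qed.

Lemma weylCD (c d : A) : weylC (c + d) = weylC c + weylC d.
Proof. exact: mpolyCD. Qed.

Lemma weylCM (c d : A) : weylC (c * d) = weylC c * weylC d.
Proof. by apply: esym; rewrite [LHS]weyl_mulrC /weylC -mul_mpolyC -mpolyCM mulrC. Qed.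

Lemma weyl_natE m : m%:R = weylC (m%:R)%:MP :> W.
Proof.
rewrite /weylC; elim: m => [|m IHm]; first by rewrite !mulr0n !mpolyC0.
by rewrite -[m.+1]addn1 !natrD IHm !mpolyCD; congr (_ + _); rewrite !mpolyC1.
Qed.
End Weyl.

(** * The operators of step (b) *)

Section Affine.
Variable k : nat.
Local Notation P := {mpoly rat[k]}.

(** This property of [f] gives both the adjunction of [scalar_product_adjoint] and
    the explicit form of the [P_i^#]. It is stable under linear combinations, so that
    the coefficients of [f], which depend on the model, do not have to be computed. *)
Definition separable_quadratic (p : P) : Prop := p@_0%MM = 0 /\
  forall i, exists alpha kappa, p^`M(i) = alpha *: 'X_i + kappa%:MP.

Lemma separable_quadraticD p q :
  separable_quadratic p -> separable_quadratic q -> separable_quadratic (p + q).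
Proof.
move=> [p0 dp] [q0 dq]; split=> [|i]; first by rewrite mcoeffD p0 q0 addr0.
have [[a [b pE]] [c [d qE]]] := (dp i, dq i); exists (a + c), (b + d).
by rewrite mderivD pE qE scalerDl mpolyCD addrACA.
Qed.

Lemma separable_quadraticZ c p : separable_quadratic p -> separable_quadratic (c *: p).
Proof.
move=> [p0 dp]; split=> [|i]; first by rewrite mcoeffZ p0 mulr0.
have [a [b pE]] := dp i; exists (c * a), (c * b).
by rewrite mderivZ pE scalerDr scalerA -[_ *: _%:MP]mul_mpolyC mpolyCM.
Qed.

Lemma separable_quadratic0 : separable_quadratic 0.
Proof.
split=> [|i]; first exact: mcoeff0.
by exists 0, 0; rewrite mderiv0 scale0r mpolyC0 addr0.
Qed.

Lemma separable_quadratic_sum (I : Type) (r : seq I) (F : I -> P) :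
  (forall i, separable_quadratic (F i)) -> separable_quadratic (\sum_(i <- r) F i).
Proof.
move=> sF; elim/big_rec: _ => [|i p _]; first exact: separable_quadratic0.
exact/separable_quadraticD.
Qed.

Lemma mderivXU (i j : 'I_k) : ('X_j : P)^`M(i) = ((j == i)%:R)%:MP.
Proof.
rewrite mderivX mnm1E; case: eqVneq => [->|_]; last by rewrite scale0r mpolyC0.
rewrite scale1r (_ : (U_(i) - U_(i))%MM = 0%MM) ?mpolyX0 //.
by apply/mnmP=> l; rewrite mnmBE subnn mnm0E.
Qed.

Lemma separable_quadratic_pvar j : separable_quadratic (pvar k j).
Proof.
rewrite /pvar; case: insub => [l|]; last exact: separable_quadratic0.
split=> [|i]; first by rewrite mcoeffX mnm1_eq0.
by exists 0, (l == i)%:R; rewrite mderivXU scale0r add0r.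
Qed.

Lemma separable_quadratic_pvar2 j : separable_quadratic (pvar k j ^+ 2).
Proof.
rewrite /pvar; case: insub => [l|]; last by rewrite expr0n; exact: separable_quadratic0.
split=> [|i].
  rewrite mcoeffXn (_ : (_ == _) = false) //; apply/eqP => /mnmP/(_ l).
  by rewrite mulmnE mnm1E eqxx mnm0E.
exists ((l == i)%:R *+ 2), 0; rewrite expr2 mderivM mderivXU mpolyC0 addr0.
case: eqVneq => [->|_]; last by rewrite mpolyC0 mul0r mulr0 addr0 mul0rn scale0r.
by rewrite mpolyC1 mulr1 mul1r mulr2n scalerDl scale1r.
Qed.

End Affine.

Section Generators.
Variable gm : graph_model.
Let k := maxdeg gm.
Local Notation A := {mpoly Qt[k]}.
Local Notation W := (weyl Qt k).

Lemma separable_quadratic_f : separable_quadratic (poly_f gm).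
Proof.
rewrite /poly_f; apply: separable_quadraticD.
  apply: separable_quadratic_sum => j; apply: separable_quadraticZ.
  by apply: separable_quadraticD; apply: separable_quadraticZ;
    [apply: separable_quadratic_pvar2 | apply: separable_quadratic_pvar].
set q := \sum_(_ <= _ < _) _.
have [c ->] : exists c : rat,
    - ((-1) ^+ (if loops gm is LoopsAllowed then 1%N else 0%N) * q) = c *: q.
  by case: (loops gm); [exists (-1) | exists 1 | exists (-1)];
    rewrite ?expr1 ?expr0 ?mulN1r ?mul1r ?opprK ?scale1r ?scaleN1r.
apply/separable_quadraticZ/separable_quadratic_sum => j.
exact/separable_quadraticZ/separable_quadratic_pvar.
Qed.

Lemma poly_f0 : (poly_f gm)@_0%MM = 0.
Proof. by case: separable_quadratic_f. Qed.

(** The coefficient map in the non-commutative substitution, named in order to carry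
    its ring morphism structure. *)
Definition weyl_rat (c : rat) : W := weylC (Qt_of_rat c)%:MP.

Lemma weyl_rat_is_additive : zmod_morphism weyl_rat.
Proof. by move=> c d; rewrite /weyl_rat /weylC rmorphB !mpolyCB. Qed.

HB.instance Definition _ := GRing.isZmodMorphism.Build rat W weyl_rat
  weyl_rat_is_additive.

Lemma weyl_rat_is_multiplicative : monoid_morphism weyl_rat.
Proof.
split=> [|c d].
  by rewrite /weyl_rat /weylC (rmorph1 Qt_of_rat) mpolyC1; exact: mpolyC1.
apply: esym; apply: etrans (weyl_mulCl _ _) _.
by rewrite /weyl_rat /weylC rmorphM mpolyCM -mul_mpolyC -mpolyCM.
Qed.

HB.instance Definition _ := GRing.isMonoidMorphism.Build rat W weyl_rat
  weyl_rat_is_multiplicative.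

Variables alpha kappa : 'I_k -> rat.
Hypothesis f_affine : forall i, f_ i = alpha i *: 'X_i + (kappa i)%:MP.

Let beta (i : 'I_k) : rat := i.+1%:R * alpha i * i.+1%:R.
Let gamma (i : 'I_k) : rat := i.+1%:R * kappa i.
Let crit : 'I_k -> A := critical (fun i => (poly_g gm)^`M(i)) beta gamma.

Lemma PsharpE (i : 'I_k) :
  Psharp i = weylC 'X_i - i.+1%:R *
    (weyl_rat (alpha i) *
       (i.+1%:R * (weylD Qt i + weylC (Qt_t *: Qtp (poly_g gm)^`M(i))))
     + weyl_rat (kappa i)).
Proof.
rewrite /Psharp f_affine -/weyl_rat; congr (_ - _ * _).
set u := fun j : 'I_k => _.
rewrite -[LHS]/(mmap weyl_rat u _) mmapD mmapC; congr (_ + _).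
by rewrite mmapZ mmapX mmap1U.
Qed.

(** The normal form is read off directly because [f_i] is affine: the substitution
    involves no product of [∂_i] with [g_i]. The constant term in [∂] generates the
    ideal of the [η_1]-coefficients. *)
Lemma Psharp_normal_form (i : 'I_k) :
  Psharp i = (crit i)%:MP - (Qt_of_rat (beta i))%:MP *: 'X_i :> {mpoly A[k]}.
Proof.
rewrite PsharpE weyl_natE !weyl_mulCl.
set n : A := (i.+1%:R)%:MP; set a : A := (Qt_of_rat (alpha i))%:MP.
set h : A := Qt_t *: _; set b : A := (Qt_of_rat (kappa i))%:MP.
have -> : crit i = 'X_i - n * a * n * h - n * b.
  rewrite /crit /critical -/h /beta /gamma !(rmorphM Qt_of_rat) !(rmorph_nat Qt_of_rat).
  by rewrite -mul_mpolyC !mpolyCM.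
have -> : (Qt_of_rat (beta i))%:MP = n * a * n.
  by rewrite /beta !(rmorphM Qt_of_rat) !(rmorph_nat Qt_of_rat) !mpolyCM.
have normal (X : {mpoly A[k]}) (x : A) :
    x%:MP - n *: (a *: (n *: (X + h%:MP)) + b%:MP) =
      (x - n * a * n * h - n * b)%:MP - (n * a * n) *: X.
  by rewrite -!mul_mpolyC !mpolyCB !mpolyCM; ring.
exact: normal.
Qed.

Lemma weyl_act_Psharp (i : 'I_k) s :
  weyl_act (Psharp i) s =
    'X_i * s - Qt_of_rat (beta i) *:
         (s^`M(i) + (Qt_t *: map_mpoly Qt_of_rat (poly_g gm)^`M(i)) * s)
    - Qt_of_rat (gamma i) *: s.
Proof.
rewrite Psharp_normal_form [LHS]weyl_actB [X in X - _]weyl_actC.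
rewrite weyl_act_const [weyl_act 'X_i s]weyl_actD /crit /critical !mulrBl mul_mpolyC.
rewrite -scalerAl scalerDr.
have reorder (x y z w : A) : x - y - z - w = x - (w + y) - z by ring.
exact: reorder.
Qed.

Lemma in_submodule_null v s :
  in_submodule v -> null (poly_f gm) (poly_g gm) (weyl_act v s).
Proof.
move=> [a ->].
have -> : weyl_act (\sum_i Psharp i * weylC (a i)) s =
    \sum_i weyl_act (Psharp i) (a i * s).
  rewrite -[LHS]/(act_on s _) (raddf_sum (act_on s)); apply: eq_bigr => i _.
  by rewrite /= weyl_mulrC /act_on weyl_actZ.
apply: null_sum => i _; rewrite weyl_act_Psharp.
exact: (null_adjoint (poly_g gm) poly_f0 (a i * s) (f_affine i)).
Qed.

Lemma in_submodule_coef0 v : in_submodule v ->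
  exists a : 'I_k -> A, v@_0%MM = \sum_i a i * crit i.
Proof.
move=> [a ->]; exists a; rewrite -[LHS]/(mcoeff 0%MM _) raddf_sum.
apply: eq_bigr => i _; rewrite /= weyl_mulrC mcoeffZ Psharp_normal_form.
rewrite mcoeffB mcoeffC eqxx mulr1 mcoeffZ mcoeffX.
by rewrite mnm1_eq0 mulr0 subr0.
Qed.

(** Taking the [η_1]-coefficient is linear over [Q(t)[p]] acting on the right, hence
    [I] is contained in the ideal generated by the [η_1]-coefficients of the
    generators. *)
Lemma in_I_neq1 (B : seq W) : (forall b, b \in B -> in_submodule b) -> ~ in_I B 1.
Proof.
move=> subB [a]; rewrite big_seq.
suff [c ->] : exists c : 'I_k -> A,
    \sum_(G <- Gs B | G \in Gs B) a G * Qpart G = \sum_i c i * crit i.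
  by move/esym; exact: critical_proper.
apply: (big_ind (fun s => exists c : 'I_k -> A, s = \sum_i c i * crit i)).
- by exists (fun=> 0); rewrite big1 // => i _; rewrite mul0r.
- move=> s t [c ->] [d ->]; exists (fun i => c i + d i); rewrite -big_split.
  by apply: eq_bigr => i _; rewrite mulrDl.
move=> G; rewrite mem_filter => /andP[_ /subB/in_submodule_coef0[c e]].
exists (fun i => a G * c i); rewrite /Qpart e mulr_sumr.
by apply: eq_bigr => i _; rewrite mulrA.
Qed.
End Generators.

(** * Reduction, and the monomials under the stairs *)

Section Correctness.
Variables (gm : graph_model) (le_p le_d : rel 'X_{1..maxdeg gm}).
Hypothesis le_p_graded : graded_order le_p.
Let k := maxdeg gm.
Local Notation A := {mpoly Qt[k]}.
Local Notation W := (weyl Qt k).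
Local Notation null := (null (poly_f gm) (poly_g gm)).
Variable B : seq W.
Hypothesis B_groebner : groebner le_p le_d B.

Let B_sub b : b \in B -> in_submodule b.
Proof. by case: B_groebner => sub _ /sub. Qed.

Lemma in_submodule_wact v s : in_submodule v -> null (weyl_act v s).
Proof.
have [_ aff] := separable_quadratic_f gm.
have [alpha affa] := fin_all_exists aff; have [kappa fE] := fin_all_exists affa.
exact: in_submodule_null fE v s.
Qed.

Lemma one_notin_I : ~ in_I B 1.
Proof.
have [_ aff] := separable_quadratic_f gm.
have [alpha affa] := fin_all_exists aff; have [kappa fE] := fin_all_exists affa.
exact: in_I_neq1 fE _ B_sub.
Qed.

Lemma reduces_irreducible s r : reduces le_p B s r ->
  forall m, m \in msupp r -> ~ reducible_by le_p B m.
Proof. by elim. Qed.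

(** Each step of [red] subtracts [G s] with [G] in the submodule. *)
Lemma reduces_null s r : reduces le_p B s r -> null (s - r).
Proof.
elim=> [{}s _|{}s {}r m G mG _ _ GB _ _ _ IH]; first by rewrite subrr; exact: null0.
set t := weyl_act G _ in IH; have -> : s - r = s - t - r + t by rewrite addrAC subrK.
apply: nullD IH _; apply: in_submodule_wact; apply: B_sub.
by move: GB; rewrite mem_filter => /andP[].
Qed.

Lemma in_submodule_comb (a : W -> A) :
  exists2 v, in_submodule v & v@_0%MM = \sum_(G <- Gs B) a G * Qpart G.
Proof.
have subD (v w : W) : in_submodule v -> in_submodule w -> in_submodule (v + w).
  move=> [c ->] [d ->]; exists (fun i => c i + d i); rewrite -big_split.
  by apply: eq_bigr => i _; rewrite weylCD mulrDr.
exists (\sum_(G <- Gs B) G * weylC (a G)).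
  rewrite big_seq; apply: (big_ind (@in_submodule gm)); [|exact: subD|].
    by exists (fun=> 0); rewrite big1 // => i _; rewrite [LHS]weyl_mulrC scale0r.
  move=> G; rewrite mem_filter => /andP[_ /B_sub[c GE]].
  exists (fun i => c i * a G); rewrite {1}GE mulr_suml; apply: eq_bigr => i _.
  by rewrite weylCM mulrA.
rewrite -[LHS]/(mcoeff 0%MM _) raddf_sum; apply: eq_bigr => G _.
by rewrite /= weyl_mulrC mcoeffZ.
Qed.

(** An element of [I] is the [η_1]-coefficient of an element of the submodule, and its
    leading monomial is that of this element by the choice of the ordering. The
    basis element whose leading monomial divides it must then have its own leading
    monomial in the [η_1] component. *)
Lemma lead_mon_I_reducible s m :
  in_I B s -> is_lead_mon le_p s m -> reducible_by le_p B m.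
Proof.
move=> [a sE] [ms lead]; have [v v_sub v0] := in_submodule_comb a.
have vs : v@_0%MM = s by rewrite v0 sE.
have v_neq0 : v != 0.
  by apply: contraTneq ms => v00; rewrite -vs v00 mcoeff0 msupp0.
have [_ /(_ v v_sub v_neq0)[b [[x1 x2] [[y1 y2] []]]]] := B_groebner.
move=> bB [/= xb leadb] [/= yv leadv] xy le_xy.
have [[anti _ _] _ _] := le_p_graded.1.
have y1_0 : y1 = 0%MM.
  apply/eqP; apply: contraT => y1_neq0.
  by have := leadv (0%MM, m); rewrite /= vs => /(_ ms); rewrite (negPf y1_neq0) eqxx.
have y2_m : y2 = m.
  apply: anti; rewrite lead; last by rewrite -vs -y1_0.
  by have := leadv (0%MM, m); rewrite /= vs y1_0 eqxx => /(_ ms).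
rewrite xy y1_0 in xb leadb; exists b, x2; split.
- by rewrite mem_filter bB andbT; apply: contraTneq xb => ->; rewrite msupp0.
- by split=> // c cb; have := leadb (0%MM, c) cb; rewrite /= eqxx.
- by rewrite -y2_m.
Qed.

Lemma irreducible_under_stairs m :
  ~ reducible_by le_p B m -> under_stairs le_p (in_I B) m.
Proof. by move=> irr [s sI /(lead_mon_I_reducible sI)]. Qed.

(** The monomial 1 is the smallest one, so it is the leading monomial of constants
    only. *)
Lemma one_under_stairs : under_stairs le_p (in_I B) 0%MM.
Proof.
move=> [s [a sE] [s0 lead]]; apply: one_notin_I.
have [[[anti _ _] min _] _] := le_p_graded.
have sC : s = (s@_0%MM)%:MP.
  apply/mpolyP=> m; rewrite mcoeffC.
  case: eqVneq => [->|m_neq0]; first by rewrite mulr1.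
  rewrite mulr0; apply: memN_msupp_eq0; apply: contra m_neq0 => ms.
  by apply/eqP/anti; rewrite lead // min.
have s0_neq0 : s@_0%MM != 0 by rewrite -mcoeff_msupp.
move: (s@_0%MM) s0_neq0 sC => c c_neq0 sC.
exists (fun G => c^-1 *: a G).
have -> : \sum_(G <- Gs B) c^-1 *: a G * Qpart G = c^-1 *: s.
  by rewrite sE scaler_sumr; apply: eq_bigr => G _; rewrite -scalerAl.
by rewrite sC -mul_mpolyC -mpolyCM mulVf // mpolyC1.
Qed.

End Correctness.

(** The matrix has one more row than columns, so its left kernel is not zero, and the
    number of trailing zeros is bounded. *)
Lemma kernel_choice_exists d (M : 'M[Qt]_(d.+1, d)) : exists q, kernel_choice M q.
Proof.
have [q0 q00 q0M] : exists2 q : 'rV[Qt]_d.+1, q != 0 & q *m M = 0.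
  have : kermx M != 0.
    rewrite -mxrank_eq0 mxrank_ker subn_eq0 -ltnNge ltnS.
    exact: rank_leq_col.
  by case/rowV0Pn => q /sub_kermxP qM q0; exists q.
have bound (q : 'rV[Qt]_d.+1) : (trailing_zeros q <= d.+1)%N.
  rewrite /trailing_zeros (leq_trans (find_size _ _)) //.
  by rewrite size_rev size_map size_enum_ord.
have [n] := ubnP (d.+1 - trailing_zeros q0); elim: n q0 q00 q0M => // n IHn q q0 qM ltn.
have [[q' [q'0 q'M lt]]|no] := classic (exists q' : 'rV[Qt]_d.+1,
    [/\ q' != 0, q' *m M = 0 & (trailing_zeros q < trailing_zeros q')%N]).
  apply: (IHn q') => //; rewrite -ltnS; apply: leq_trans ltn.
  by rewrite ltnS ltn_sub2l // (leq_trans lt).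
exists q; split=> // q' q'0 q'M; rewrite leqNgt; apply/negP => lt.
by apply: no; exists q'.
Qed.

(** * Correctness of the algorithm *)

Section MatrixKernel.
Variables (gm : graph_model) (le_p le_d : rel 'X_{1..maxdeg gm}).
Hypothesis le_p_graded : graded_order le_p.
Local Notation null := (null (poly_f gm) (poly_g gm)).
Local Notation wderiv := (weighted_deriv (poly_g gm)).

(** The polynomials of step (g) agree with [(g + ∂_t)^i 1] modulo null polynomials, and
    the kernel relation holds between them exactly, not only for the coefficients
    recorded in the matrix, as their monomials are all under the stairs. *)
Lemma computed_matrix_kernel_null d (M : 'M[Qt]_(d.+1, d)) (q : 'rV[Qt]_d.+1) :
  computes_matrix le_p le_d M -> q *m M = 0 -> null (\sum_i q 0 i *: iter i wderiv 1).
Proof.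
move=> [B [beta [gc [[gB _] [beta_uniq betaE] gc0 gcS ME]]]] qM.
have gc_null i : (i <= d)%N -> null (iter i wderiv 1 - gc i).
  elim: i => [|i IHi] lt_id; first by rewrite gc0 subrr; exact: null0.
  have := null_weighted_deriv (IHi (ltnW lt_id)); rewrite weighted_derivB -iterS.
  move/nullD/(_ (reduces_null gB (gcS i lt_id))); rewrite addrA subrK.
  exact.
have gc_supp i m : (i <= d)%N -> m \in msupp (gc i) -> m \in beta.
  (* The initial polynomial 1 is not a result of [red]. *)
  case: i => [|i] lt_id.
    rewrite gc0 msupp1 inE => /eqP ->; apply/betaE.
    exact (one_under_stairs le_p_graded gB).
  move=> ms; apply/betaE/(irreducible_under_stairs le_p_graded gB).
  exact: (reduces_irreducible (gcS i lt_id) ms).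
have gc_sum : \sum_i q 0 i *: gc i = 0.
  apply/mpolyP=> m; rewrite raddf_sum mcoeff0 /=.
  have [mb|nmb] := boolP (m \in beta); last first.
    rewrite big1 // => i _; rewrite mcoeffZ memN_msupp_eq0 ?mulr0 //.
    by apply: contra nmb; apply: gc_supp; rewrite -ltnS.
  have /tnthP[j mE] := mb.
  have := congr1 (fun N : 'rV_d => N 0 j) qM; rewrite !mxE.
  by apply: etrans; apply: eq_bigr => i _; rewrite mcoeffZ ME mE mxE.
have : null (\sum_i q 0 i *: (iter i wderiv 1 - gc i)).
  by apply: null_sum => i _; apply/nullZ/gc_null; rewrite -ltnS.
under eq_bigr => j _ do rewrite scalerBr.
by rewrite sumrB gc_sum subr0.
Qed.

End MatrixKernel.

Theorem theorem11 (gm : graph_model) (le_p le_d : rel 'X_{1..maxdeg gm})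
    (le_p_graded : graded_order le_p) (le_d_total : total_order le_d) :
  (forall (d : nat) (M : 'M[Qt]_(d.+1, d)),
     computes_matrix le_p le_d M -> exists q, kernel_choice M q) /\
  (forall out : outcome, returns le_p le_d out ->
     out = Fail \/
     exists (d : nat) (q : 'rV[Qt]_d.+1),
       [/\ out = Operator q, q != 0 & annihilates q (graph_series gm)]).
Proof.
split=> [d M _|out]; first exact: kernel_choice_exists.
case=> [B _ _|d M q comp [q0 qM _]]; first by left.
right; exists d, q; split=> //.
apply: null_annihilates (computed_matrix_kernel_null le_p_graded comp qM).
exact: pairing1.
Qed.
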